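(* Let $H\in[1/2,1)$, $\alpha\ge0$, $\gamma>0$, $t_0\ge0$, $r>1$. Let $X(t)$ be the solution (given by its Karhunen-Loève expansion in the context) of the fractional SPDE $dX(t)+\psi(-\Delta^{*})X(t)\,dt=dB^{H}(t)$ on $\mathbb{S}^2$ with $X(0)=u(t_0)$, where the variances $\mathcal{A}_\ell$ of the fractional Brownian motion $B^{H}(t)$ satisfy $\sum_{\ell=0}^{\infty}\mathcal{A}_\ell(1+\ell)^{2r+1}<\infty$. Let $L\ge1$ be an integer and let $X_L(t)$ be the Karhunen-Loève approximation of degree $L$ of $X(t)$. Then for $t>0$ the truncation error satisfies $$\|X(t)-X_L(t)\|_{L_2(\Omega\times\mathbb{S}^2)}\le C\,L^{-r},$$ where the constant $C$ depends only on $\alpha$, $\gamma$, $t_0$, $t$ and $r$.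
   Context: $\mathbb{S}^2\subset\mathbb{R}^3$ is the unit sphere with normalized surface measure $\mu$ ($\mu(\mathbb{S}^2)=1$), $(\Omega,\mathcal F,P)$ is a probability space, and $\|Z\|_{L_2(\Omega\times\mathbb{S}^2)}^2=E\int_{\mathbb{S}^2}|Z|^2d\mu$. In spherical coordinates $(\theta,\varphi)$, $\{Y_{\ell,m}:\ell\ge0,\ -\ell\le m\le\ell\}$ is the complex orthonormal basis of spherical harmonics (orthonormal with respect to $\mu$), $Y_{\ell,m}=\sqrt{(2\ell+1)\frac{(\ell-m)!}{(\ell+m)!}}\,P_\ell^{m}(\cos\theta)e^{im\varphi}$, with $P_\ell^m$ the associated Legendre function of degree $\ell$ and order $m$, and $Y_{\ell,m}=(-1)^m\overline{Y_{\ell,-m}}$. Fourier coefficients are $\widehat f_{\ell m}=\int f\,\overline{Y_{\ell,m}}\,d\mu$. $\Delta^{*}$ is the Laplace-Beltrami operator on $\mathbb{S}^2$, $-\Delta^{*}Y_{\ell,m}=\lambda_\ell Y_{\ell,m}$, $\lambda_\ell=\ell(\ell+1)$; $\psi(t)=t^{\alpha/2}(1+t)^{\gamma/2}$ for $t\ge0$; $\psi(-\Delta^{*})$ has eigenvalue $\psi(\lambda_\ell)$ on $Y_{\ell,m}$. $T_0$ is a centered ($E[T_0(\mathbf{x})]=0$), $2$-weakly isotropic (finite second moments, rotation-invariant first and second order moments) real Gaussian random field on $\mathbb{S}^2$, and $u(t)=\sum_{\ell=0}^\infty\sum_{m=-\ell}^{\ell}e^{-\psi(\lambda_\ell)t}\widehat{(T_0)}_{\ell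 m}Y_{\ell,m}$, the solution of the Cauchy problem $\partial_tu+\psi(-\Delta^{*})u=0$, $u(0)=T_0$. A real fractional Brownian motion (fBm) with Hurst index $H$ and variance $1$ at $t=1$ is a centered Gaussian process $\beta$ on $[0,\infty)$ with $\beta(0)=0$, $E|\beta(t)-\beta(s)|^2=|t-s|^{2H}$ (Brownian motion if $H=1/2$). Let $\mathcal{A}_\ell>0$ with $\sum_\ell(2\ell+1)\mathcal{A}_\ell<\infty$, and let $\beta^1_{\ell m}$ ($0\le m\le\ell$), $\beta^2_{\ell m}$ ($1\le m\le\ell$), $\ell\ge0$, be independent such fBms. The (real-valued) fBm on $\mathbb{S}^2$ with Hurst index $H$ and variances $\mathcal{A}_\ell$ is $B^{H}(t)=\sum_{\ell=0}^\infty\sqrt{\mathcal{A}_\ell}\bigl(\beta^1_{\ell0}(t)Y_{\ell,0}+\sqrt2\sum_{m=1}^{\ell}(\beta^1_{\ell m}(t)\mathrm{Re}\,Y_{\ell,m}+\beta^2_{\ell m}(t)\mathrm{Im}\,Y_{\ell,m})\bigr)$ in $L_2(\Omega\times\mathbb{S}^2)$. Integrals of deterministic functions against $\beta^i_{\ell m}$ are Riemann-Stieltjes integrals. Write $I^i_{\ell m}(t)=\int_0^te^{-\psi(\lambda_\ell)(t-s)}d\beta^i_{\ell m}(s)$. The solution is $$X(t)=\sum_{\ell=0}^{\infty}\Bigl(\sum_{m=-\ell}^{\ell}e^{-\psi(\lambda_\ell)(t+t_0)}\widehat{(T_0)}_{\ell m}Y_{\ell,m}+\sqrt{\mathcal{A}_\ell}\Bigl(I^1_{\ell0}(t)Y_{\ell,0}+\sqrt2\sum_{m=1}^{\ell}\bigl(I^1_{\ell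 m}(t)\mathrm{Re}\,Y_{\ell,m}+I^2_{\ell m}(t)\mathrm{Im}\,Y_{\ell,m}\bigr)\Bigr)\Bigr),$$ and $X_L(t)$ is the same expression with the outer sum restricted to $0\le\ell\le L$.
   Formalization: The constant C may also depend on the initial field T_0 (with its probability space) and on the variances A_ℓ, since scaling T_0 by c and A_ℓ by c^2 multiplies the error by c; C remains uniform in H, L and the fractional Brownian motions. *)

(* Defs.v *)
From HB Require Import structures.
From mathcomp Require Import all_boot all_order all_algebra.
From mathcomp Require Import all_classical all_reals all_analysis.
From mathcomp Require Import measurable_realfun.
From mathcomp Require Import complex.

Set Implicit Arguments.
Unset Strict Implicit.
Unset Printing Implicit Defensive.

Import Order.TTheory GRing.Theory Num.Theory.
Import numFieldNormedType.Exports.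

Local Open Scope classical_set_scope.
Local Open Scope ring_scope.
Local Open Scope complex_scope.

Section Sphere.
Context {R : realType}.

(* Functions on the sphere are functions on R^3 that are only ever evaluated,
   measured and integrated on [sphere]. *)
Definition sphere : set (3.-tuple R) :=
  [set x | \sum_(i < 3) tnth x i ^+ 2 = 1].

Definition spherical (p : R * R) : 3.-tuple R :=
  [tuple sin p.1 * cos p.2; sin p.1 * sin p.2; cos p.1].

Definition spherical_dom : set (R * R) := `[0, pi] `*` `[0, 2 * pi].

(* mu(A) is the integral of sin(theta) / (4 pi) over the pairs (theta, phi)
   whose image lies in A. *)
Definition sphere_measure (A : set (3.-tuple R)) : \bar R :=
  (\int[(@lebesgue_measure R \x @lebesgue_measure R)%E]_(p in
     spherical_dom `&` spherical @^-1` A) (sin p.1 / (4 * pi))%:E)%E.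

Lemma measurable_spherical_dom : measurable spherical_dom.
Proof. by apply: measurableX; exact: measurable_itv. Qed.

Lemma measurable_spherical : measurable_fun setT spherical.
Proof.
have mS (g : R * R -> R) : measurable_fun setT g ->
    measurable_fun setT (fun p => sin (g p)).
  move=> mg; apply: measurableT_comp => //.
  by apply: continuous_measurable_fun; exact: continuous_sin.
have mC (g : R * R -> R) : measurable_fun setT g ->
    measurable_fun setT (fun p => cos (g p)).
  move=> mg; apply: measurableT_comp => //.
  by apply: continuous_measurable_fun; exact: continuous_cos.
have m1 := @measurable_fst _ _ R R; have m2 := @measurable_snd _ _ R R.
apply/measurable_fun_tnthP => -[[|[|[|//]]] i3].
- by apply: measurable_funM; [exact: mS|exact: mC].
- by apply: measurable_funM; [exact: mS|exact: mS].
- exact: mC.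
Qed.

Let dens_ge0 (p : R * R) : spherical_dom p -> (0 <= (sin p.1 / (4 * pi))%:E)%E.
Proof.
move=> [/= p1 _]; rewrite lee_fin divr_ge0 ?mulr_ge0 ?pi_ge0//.
by apply: sin_ge0_pi; move: p1; rewrite in_itv.
Qed.

Let measurable_dens (D : set (R * R)) :
  measurable_fun D (fun p : R * R => (sin p.1 / (4 * pi))%:E).
Proof.
apply/measurable_EFinP; apply: measurable_funM => //.
apply: measurable_funTS; apply: measurableT_comp; last exact: measurable_fst.
by apply: continuous_measurable_fun; exact: continuous_sin.
Qed.

Let sphere_measure0 : sphere_measure set0 = 0%E.
Proof. by rewrite /sphere_measure preimage_set0 setI0 integral_set0. Qed.

Let sphere_measure_ge0 A : (0 <= sphere_measure A)%E.
Proof. by apply: integral_ge0 => p [/dens_ge0]. Qed.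

Let sphere_measure_sigma_additive : semi_sigma_additive sphere_measure.
Proof.
move=> F mF tF mUF; rewrite /sphere_measure preimage_bigcup setI_bigcupr.
have mG k : measurable (spherical_dom `&` spherical @^-1` F k).
  apply: measurableI; first exact: measurable_spherical_dom.
  by rewrite -[X in measurable X]setTI; exact: measurable_spherical.
rewrite ge0_integral_bigcup//.
- apply: is_cvg_ereal_nneg_natsum_cond => n _ _.
  by apply: integral_ge0 => p [/dens_ge0].
- exact: measurable_dens.
- by move=> p [k _ [/dens_ge0]].
- move=> i j _ _ [p [[_ Fip] [_ Fjp]]].
  exact: (tF i j I I (ex_intro _ (spherical p) (conj Fip Fjp))).
Qed.

HB.instance Definition _ := isMeasure.Build _ _ _ sphere_measure
  sphere_measure0 sphere_measure_ge0 sphere_measure_sigma_additive.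

Definition is_rotation (Q : 'M[R]_3) : Prop := Q *m Q^T = 1%:M /\ \det Q = 1.

Definition rotate (Q : 'M[R]_3) (x : 3.-tuple R) : 3.-tuple R :=
  [tuple \sum_(j < 3) Q i j * tnth x j | i < 3].

End Sphere.

Section Harmonics.
Context {R : realType}.

Definition colatitude (x : 3.-tuple R) : R := acos (tnth x (inord 2)).

(* The angle in [0, 2 pi[ of (x_0, x_1), with value 0 at the two poles. *)
Definition longitude (x : 3.-tuple R) : R :=
  let a := tnth x (inord 0) in
  let b := tnth x (inord 1) in
  let rho := Num.sqrt (a ^+ 2 + b ^+ 2) in
  if rho == 0 then 0
  else if 0 <= b then acos (a / rho) else 2 * pi - acos (a / rho).

(* Rodrigues' formula. *)
Definition legendre (l : nat) : {poly R} :=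
  (2 ^+ l * (l`!)%:R)^-1 *: (('X ^+ 2 - 1) ^+ l)^`(l).

(* Condon-Shortley convention; negative orders -n, i.e. [Negz n.-1], are given
   by P_l^{-n} = (-1)^n (l-n)!/(l+n)! P_l^n. *)
Definition assoc_legendre_nat (l m : nat) (x : R) : R :=
  (-1) ^+ m * Num.sqrt (1 - x ^+ 2) ^+ m * ((legendre l)^`(m)).[x].

Definition assoc_legendre (l : nat) (m : int) (x : R) : R :=
  match m with
  | Posz n => assoc_legendre_nat l n x
  | Negz n => (-1) ^+ n.+1 * ((l - n.+1)`!)%:R / ((l + n.+1)`!)%:R *
              assoc_legendre_nat l n.+1 x
  end.

Definition cis (a : R) : R[i] := cos a +i* sin a.

Definition sph_harmonic (l : nat) (m : int) (x : 3.-tuple R) : R[i] :=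
  (Num.sqrt ((2 * l + 1)%:R *
     ((absz (l%:Z - m))`!)%:R / ((absz (l%:Z + m))`!)%:R) *
   assoc_legendre l m (cos (colatitude x)))%:C *
  cis (m%:~R * longitude x).

Definition sum_orders (l : nat) (F : int -> R[i]) : R[i] :=
  \sum_(k < (2 * l).+1) F (k%:Z - l%:Z).

Definition sphere_cintegral (f : 3.-tuple R -> R[i]) : R[i] :=
  (\int[@sphere_measure R]_(x in sphere) complex.Re (f x)) +i*
  (\int[@sphere_measure R]_(x in sphere) complex.Im (f x)).

Definition fourier_coef (f : 3.-tuple R -> R[i]) (l : nat) (m : int) : R[i] :=
  sphere_cintegral (fun x => f x * (sph_harmonic l m x)^*).

Definition LB_eigenvalue (l : nat) : R := (l * l.+1)%:R.

(* [powR] satisfies 0 `^ 0 = 1, the convention needed when alpha = 0. *)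
Definition psi (alpha gamma t : R) : R :=
  t `^ (alpha / 2) * (1 + t) `^ (gamma / 2).

End Harmonics.

Section Probability.
Context {R : realType} {d : measure_display} {Omega : measurableType d}.
Variable P : probability Omega R.

(* Constants are Gaussian; [normal_prob m 0] is not the Dirac mass at m. *)
Definition gaussian_rv (Z : Omega -> R) : Prop :=
  measurable_fun setT Z /\
  exists m s : R, forall A : set R, measurable A ->
    P (Z @^-1` A) = if s == 0 then \d_m A else normal_prob m s A.

Definition gaussian_family (T : Type) (D : set T) (Z : T -> Omega -> R) : Prop :=
  forall (n : nat) (x : 'I_n -> T) (c : 'I_n -> R), (forall i, D (x i)) ->
    gaussian_rv (fun w => \sum_(i < n) c i * Z (x i) w).

Definition random_field (T : Omega -> 3.-tuple R -> R) : Prop :=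
  measurable_fun ([set: Omega] `*` sphere)
    (fun p : Omega * 3.-tuple R => T p.1 p.2).

Definition centered_field (T : Omega -> 3.-tuple R -> R) : Prop :=
  forall x, sphere x -> ('E_P[fun w => T w x] = 0)%E.

Definition weakly_isotropic2 (T : Omega -> 3.-tuple R -> R) : Prop :=
  [/\ forall x, sphere x -> ('E_P[fun w => (T w x ^+ 2)%R] < +oo)%E,
      forall Q x, is_rotation Q -> sphere x ->
        ('E_P[fun w => T w (rotate Q x)] = 'E_P[fun w => T w x])%E &
      forall Q x y, is_rotation Q -> sphere x -> sphere y ->
        ('E_P[fun w => (T w (rotate Q x) * T w (rotate Q y))%R] =
         'E_P[fun w => (T w x * T w y)%R])%E].

Definition gaussian_field (T : Omega -> 3.-tuple R -> R) : Prop :=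
  gaussian_family sphere (fun x w => T w x).

Definition is_fBm (H : R) (b : R -> Omega -> R) : Prop :=
  [/\ gaussian_family [set t | 0 <= t] b,
      forall t, 0 <= t -> ('E_P[b t] = 0)%E,
      {ae P, forall w, b 0 w = 0} &
      forall s t, 0 <= s -> 0 <= t ->
        ('E_P[fun w => ((b t w - b s w) ^+ 2)%R] = (`|t - s| `^ (2 * H))%:E)%E].

Definition process_sigma_algebra (b : R -> Omega -> R) : set (set Omega) :=
  <<s [set E | exists2 t, 0 <= t &
               exists2 A : set R, measurable A & E = b t @^-1` A] >>.

Definition independent_processes (I : choiceType) (D : set I)
    (b : I -> R -> Omega -> R) : Prop :=
  forall (s : seq I) (E : I -> set Omega), uniq s ->
    (forall i, i \in s -> D i /\ process_sigma_algebra (b i) (E i)) ->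
    P (\bigcap_(i in [set` s]) E i) = (\prod_(i <- s) P (E i))%E.

(* [(false, l, m)] is the index of beta^1_{lm} and [(true, l, m)] that of
   beta^2_{lm}. *)
Definition fBm_index : set (bool * nat * nat) :=
  [set i : bool * nat * nat |
   (i.2 <= i.1.2)%N /\ (i.1.1 = true -> (0 < i.2)%N)].

Definition independent_fBms (H : R) (b1 b2 : nat -> nat -> R -> Omega -> R) :
    Prop :=
  let b i := if i.1.1 then b2 i.1.2 i.2 else b1 i.1.2 i.2 in
  (forall i, fBm_index i -> is_fBm H (b i)) /\
  independent_processes fBm_index b.

Definition tagged_partition (a b : R) (n : nat) (s xi : nat -> R) : Prop :=
  [/\ s 0%N = a, s n = b &
      forall i, (i < n)%N -> s i <= xi i /\ xi i <= s i.+1].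

Definition RS_sum (f g : R -> R) (n : nat) (s xi : nat -> R) : R :=
  \sum_(i < n) f (xi i) * (g (s i.+1) - g (s i)).

(* Z is the Riemann-Stieltjes integral of f against b on [lo, hi].  The sums
   are required to converge in probability as the mesh tends to 0: this holds
   both for the pathwise integral (when b has continuous paths) and for the
   mean-square one. *)
Definition is_RS_integral (f : R -> R) (b : R -> Omega -> R) (lo hi : R)
    (Z : Omega -> R) : Prop :=
  measurable_fun setT Z /\
  forall e : R, 0 < e -> exists2 delta : R, 0 < delta &
    forall n s xi, tagged_partition lo hi n s xi ->
      (forall i, (i < n)%N -> s i.+1 - s i < delta) ->
      (P [set w | e < `|RS_sum f (b ^~ w) n s xi - Z w|]%R <= e%:E)%E.

Definition L2norm (Z : Omega -> 3.-tuple R -> R[i]) : \bar R :=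
  ((\int[P]_w \int[@sphere_measure R]_(x in sphere)
      ((complex.Re (Z w x) ^+ 2 + complex.Im (Z w x) ^+ 2)%R)%:E) `^ 2^-1)%E.

Definition is_L2_limit (S : nat -> Omega -> 3.-tuple R -> R[i])
    (Z : Omega -> 3.-tuple R -> R[i]) : Prop :=
  [/\ random_field (fun w x => complex.Re (Z w x)),
      random_field (fun w x => complex.Im (Z w x)) &
      (fun N => L2norm (fun w x => Z w x - S N w x)) @ \oo --> 0%E].

Definition real_expansion (l : nat) (a1 a2 : nat -> nat -> Omega -> R)
    (w : Omega) (x : 3.-tuple R) : R[i] :=
  (a1 l 0%N w)%:C * sph_harmonic l 0 x +
  (Num.sqrt 2 * \sum_(1 <= m < l.+1)
     (a1 l m w * complex.Re (sph_harmonic l m x) +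
      a2 l m w * complex.Im (sph_harmonic l m x)))%:C.

Definition sphere_fBm_partial (A : nat -> R)
    (b1 b2 : nat -> nat -> R -> Omega -> R) (t : R) (N : nat)
    (w : Omega) (x : 3.-tuple R) : R[i] :=
  \sum_(l < N.+1) (Num.sqrt (A l))%:C *
    real_expansion l (fun l m => b1 l m t) (fun l m => b2 l m t) w x.

Definition is_sphere_fBm (H : R) (A : nat -> R)
    (b1 b2 : nat -> nat -> R -> Omega -> R)
    (B : R -> Omega -> 3.-tuple R -> R[i]) : Prop :=
  independent_fBms H b1 b2 /\
  forall t, 0 <= t -> is_L2_limit (sphere_fBm_partial A b1 b2 t) (B t).

(* I1 and I2 are the stochastic convolutions I^1_{lm}(t) and I^2_{lm}(t). *)
Definition stochastic_convolutions (alpha gamma : R)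
    (b1 b2 I1 I2 : nat -> nat -> R -> Omega -> R) : Prop :=
  let kernel l t := fun s => expR (- psi alpha gamma (LB_eigenvalue l) * (t - s)) in
  forall l m t, (m <= l)%N -> 0 <= t ->
    is_RS_integral (kernel l t) (b1 l m) 0 t (I1 l m t) /\
    ((0 < m)%N -> is_RS_integral (kernel l t) (b2 l m) 0 t (I2 l m t)).

Definition KL_approx (alpha gamma t0 : R) (A : nat -> R)
    (T0 : Omega -> 3.-tuple R -> R) (I1 I2 : nat -> nat -> R -> Omega -> R)
    (t : R) (L : nat) (w : Omega) (x : 3.-tuple R) : R[i] :=
  \sum_(l < L.+1)
    (sum_orders l (fun m =>
       (expR (- psi alpha gamma (LB_eigenvalue l) * (t + t0)))%:C *
       fourier_coef (fun y => (T0 w y)%:C) l m * sph_harmonic l m x) +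
     (Num.sqrt (A l))%:C *
     real_expansion l (fun l m => I1 l m t) (fun l m => I2 l m t) w x).

Definition is_KL_solution (alpha gamma t0 : R) (A : nat -> R)
    (T0 : Omega -> 3.-tuple R -> R) (I1 I2 : nat -> nat -> R -> Omega -> R)
    (X : R -> Omega -> 3.-tuple R -> R[i]) : Prop :=
  forall t, 0 <= t -> is_L2_limit (KL_approx alpha gamma t0 A T0 I1 I2 t) (X t).

End Probability.

(* Main.v *)
From HB Require Import structures.
Require Import Defs.
From mathcomp Require Import all_boot all_order all_algebra.
From mathcomp Require Import all_classical all_reals all_analysis.
From mathcomp Require Import measurable_realfun.
From mathcomp Require Import complex.
From mathcomp Require Import zify ring lra.

Set Implicit Arguments.
Unset Strict Implicit.
Unset Printing Implicit Defensive.

Import Order.TTheory GRing.Theory Num.Theory.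
Import numFieldNormedType.Exports.

Local Open Scope classical_set_scope.
Local Open Scope ring_scope.

                                                                        
                                                                         
                                                                      

                                                                           
                                                                           
                                                                                       
                                                                
                                                                             
                                                                            
                                          

                                                                           
                                                                           
                                                                          
                                            

                                      

(** Write [rate] for L^(-r). The expansion converges in L_2, so some N >= L satisfies ||X(t) -
    X_N(t)|| <= [rate]. Then X - X_L is the sum of X - X_N, of the degrees L+1..N of the
    initial-value part, and of the degrees L+1..N of the noise part. By |a+b+c|^2 <=
    3(|a|^2+|b|^2+|c|^2) it remains to bound the squared norms of the last two by a constant times
    L^(-2r), uniformly in N.

    Initial part. Since psi(lambda_l) >= l^gamma for l >= 1, the factor exp(-psi(lambda_l)(t+t0))
    decays faster than any power of l, and the sum of (2l+1) times it over l > L is O(L^(-r))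
    ([decay_sum]). Cauchy-Schwarz with these exponentials as weights, together with ||Y_{l,m}|| <= 1
    and |f^_{l,m}| <= ||f||, bounds the squared norm by (sum of the weights)^2 E||T0||^2
    ([integral_sqr_fourier_sum_le]). Isotropy makes E T0(x)^2 constant on the sphere, so E||T0||^2
    is finite ([isotropic_second_moment_lty]).

    Noise part. For each outcome it is a finite sum of real spherical harmonics, whose squared norm
    is given by Parseval ([integral_harmonic_sum_sqr]). This rests on the orthogonality of cosines
    and sines in the longitude ([Rintegral_trig]) and of associated Legendre functions in the
    colatitude ([J_assoc_legendre]). Every stochastic convolution has second moment at most K =
    8(1+t^2)+3, whatever H, l and m are ([stochastic_convolution_second_moment]): the kernel
    increases with values in [0,1], so Abel summation turns a Riemann-Stieltjes sum into a
    combination of increments beta(s) - beta(0) whose coefficients have total absolute value at most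
    2, while E|beta(s)-beta(0)|^2 = s^(2H) <= 1+t^2; the bound then passes to the limit in
    probability ([second_moment_cvg_proba]). Degree l contributes at most 4(l+1) A_l K, and
    (1+l)^(2r+1) >= (1+l) L^(2r) for l > L turns the assumption on the variances into a bound of
    order L^(-2r) ([noise_tail_le]).

    All ingredients of the constant are fixed before H, the Brownian motions and L are
    introduced. *)

(** * Orthogonality of associated Legendre functions, by integration by parts on polynomials *)

Section AssociatedLegendre.
Context {R : realType}.
Implicit Types p q : {poly R}.

Lemma coefM_top p q (a b : nat) : (size p <= a.+1)%N -> (size q <= b.+1)%N ->
  (p * q)`_(a + b) = p`_a * q`_b.
Proof.
move=> sp sq; rewrite coefM (bigD1 (inord a)) //= inordK ?ltnS ?leq_addr//.
rewrite addKn big1 ?addr0// => i; rewrite -val_eqE /= inordK ?ltnS ?leq_addr//.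
rewrite neq_ltn => /orP[ia|ai].
  rewrite [q`_ _]nth_default ?mulr0// (leq_trans sq)// ltn_subRL.
  by rewrite ltn_add2r.
by rewrite [p`_ _]nth_default ?mul0r// (leq_trans sp).
Qed.

Lemma coefX_top p (a n : nat) : (size p <= a.+1)%N ->
  (size (p ^+ n) <= (n * a).+1)%N /\ (p ^+ n)`_(n * a) = p`_a ^+ n.
Proof.
move=> sp; elim: n => [|n [IHs IHc]].
  by rewrite !expr0 mul0n size_poly1 coef1.
rewrite mulSn exprS; split; last by rewrite coefM_top// IHc exprS.
by apply: leq_trans (size_polyMleq _ _) _; lia.
Qed.

(** Each derivative costs at most one factor ['X - a%:P]. The exponent is written [k + j] so that
    the induction on [j] keeps [k] fixed. *)
Lemma derivn_XsubC_exp (a : R) (j k : nat) p :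
  exists q, (('X - a%:P) ^+ (k + j) * p)^`(j) = ('X - a%:P) ^+ k * q.
Proof.
elim: j p => [|j IHj] p; first by exists p; rewrite derivn0 addn0.
have [q qE] := IHj (p *+ (k + j.+1) + ('X - a%:P) * p^`()).
exists q; rewrite derivSn -qE; congr (_^`(_)).
rewrite derivM deriv_exp derivXsubC addnS /= exprSr; ring.
Qed.

Lemma derivn_XsubC_exp_root (a : R) (j n : nat) p : (j < n)%N ->
  (('X - a%:P) ^+ n * p)^`(j).[a] = 0.
Proof.
move=> jn; rewrite -(subnK (ltnW jn)).
have [q ->] := derivn_XsubC_exp a j (n - j) p.
by rewrite hornerM horner_exp hornerXsubC subrr expr0n subn_eq0 leqNgt jn mul0r.
Qed.

Lemma XX1E : 'X ^+ 2 - 1 = ('X - 1%:P) * ('X - (- 1)%:P) :> {poly R}.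
Proof. by rewrite polyCN polyC1; ring. Qed.

Lemma derivn_XX1_exp_root (j n : nat) p : (j < n)%N ->
  (('X ^+ 2 - 1) ^+ n * p)^`(j).[1] = 0 /\
  (('X ^+ 2 - 1) ^+ n * p)^`(j).[- 1] = 0.
Proof.
move=> jn; rewrite XX1E exprMn; split.
  by rewrite -mulrA derivn_XsubC_exp_root.
by rewrite [X in X * _]mulrC -mulrA derivn_XsubC_exp_root.
Qed.

Lemma signr_mulZ (n : nat) p : (- 1) ^+ n * p = (- 1) ^+ n *: p.
Proof. by rewrite -mul_polyC rmorphXn rmorphN rmorph1. Qed.

(** [J] stands for integration over [-1, 1]. On polynomials, linearity and the fundamental theorem
    of calculus are all that the computations below rely on; the instance is [polar_int], the same
    integral in the variable cos theta. *)
Variable J : {poly R} -> R.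
Hypothesis JB : forall p q, J (p - q) = J p - J q.
Hypothesis JZ : forall (a : R) p, J (a *: p) = a * J p.
Hypothesis Jderiv : forall p, J p^`() = p.[1] - p.[- 1].

Lemma J_by_parts (n : nat) p q :
  (forall j, (j < n)%N -> p^`(j).[1] = 0 /\ p^`(j).[- 1] = 0) ->
  J (p^`(n) * q) = (- 1) ^+ n * J (p * q^`(n)).
Proof.
elim: n q => [|n IHn] q pn; first by rewrite expr0 mul1r.
have [p1 pN1] := pn n (ltnSn n).
have -> : p^`(n.+1) * q = (p^`(n) * q)^`() - p^`(n) * q^`().
  by rewrite derivM -derivnS addrK.
rewrite JB Jderiv !hornerM p1 pN1 !mul0r subrr sub0r IHn.
  by rewrite -derivSn exprS -mulrA mulN1r.
by move=> j jn; apply: pn; exact: ltnW.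
Qed.

Lemma size_XX1 : (size ('X ^+ 2 - 1 : {poly R})%R <= 3)%N.
Proof. by rewrite -['X^2 - 1]/('X^2 - 1%:P) size_XnsubC. Qed.

Lemma size_1XX : (size (1 - 'X ^+ 2 : {poly R})%R <= 3)%N.
Proof. by rewrite -opprB size_polyN size_XX1. Qed.

Lemma coef2_XX1 : ('X ^+ 2 - 1 : {poly R})`_2 = 1.
Proof. by rewrite coefB coefXn coef1 subr0. Qed.

Lemma coef2_1XX : (1 - 'X ^+ 2 : {poly R})`_2 = - 1.
Proof. by rewrite -opprB coefN coef2_XX1. Qed.

Lemma size_derivn (n a : nat) p : (size p <= a + n)%N -> (size p^`(n) <= a)%N.
Proof.
move=> sp; apply/leq_sizeP => j aj; rewrite coef_derivn nth_default ?mul0rn//.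
by apply: leq_trans sp _; rewrite addnC leq_add2l.
Qed.

Lemma size_legendre (l : nat) : (size (legendre l : {poly R}) <= l.+1)%N.
Proof.
apply: leq_trans (size_scale_leq _ _) _; apply: size_derivn.
apply: leq_trans (proj1 (coefX_top l size_XX1)) _.
by rewrite muln2 -addnn addSn.
Qed.

Lemma coef_legendre (l : nat) : (legendre l : {poly R})`_l =
  (2 ^+ l * (l`!)%:R)^-1 * ((2 * l)`!)%:R / (l`!)%:R.
Proof.
have l0 : (l`!)%:R != 0 :> R by rewrite pnatr_eq0 -lt0n fact_gt0.
rewrite coefZ coef_derivn addnn -muln2.
have [_ ->] := coefX_top l size_XX1; rewrite coef2_XX1 expr1n.
rewrite -mulrA; congr (_ * _); apply/eqP; rewrite -mulr_natl mulr1.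
rewrite eq_sym; apply/eqP; apply: (mulIf l0); rewrite divfK// -natrM.
rewrite (mulnC l 2) -(@ffact_fact (2 * l) l) ?leq_pmull//.
by rewrite mul2n -addnn addnK.
Qed.

                                                                         
(** The polynomial X(1-X^2)^(n+1) vanishes at 1 and -1, so its derivative integrates to 0. Expanding
    that derivative gives the recursion (2n+3) J_{n+1} = (2n+2) J_n. *)
Lemma J_1XX_exp (n : nat) : J ((1 - 'X ^+ 2) ^+ n) =
  2 ^+ (2 * n).+1 * (n`!)%:R ^+ 2 / ((2 * n).+1`!)%:R.
Proof.
elim: n => [|n IHn].
  rewrite expr0 muln0 -derivX Jderiv !hornerX expr1 fact0 expr1n factS fact0; lra.
have JE : J ((1 - 'X ^+ 2) ^+ n.+1) = (2 * n.+1)%:R / (2 * n.+1).+1%:R *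
    J ((1 - 'X ^+ 2) ^+ n).
  have E : ('X * (1 - 'X ^+ 2) ^+ n.+1)^`() = (2 * n.+1).+1%:R *:
      (1 - 'X ^+ 2) ^+ n.+1 - (2 * n.+1)%:R *: (1 - 'X ^+ 2) ^+ n :> {poly R}.
    rewrite derivM derivX deriv_exp derivB derivXn -[1]/(1%:P) derivC /=.
    rewrite !scaler_nat !exprS; ring.
  have := Jderiv ('X * (1 - 'X ^+ 2) ^+ n.+1).
  rewrite E JB !JZ !hornerM !horner_exp !hornerE sqrrN expr1n subrr.
  rewrite expr0n /= !mulr0 subr0 => /eqP; rewrite subr_eq0 => /eqP h.
  have n0 : (2 * n.+1).+1%:R != 0 :> R by rewrite pnatr_eq0.
  by apply: (mulfI n0); rewrite h mulrA mulrCA divff// mulr1.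
have f0 : ((2 * n).+1`!)%:R != 0 :> R by rewrite pnatr_eq0 -lt0n fact_gt0.
rewrite JE IHn mulnS !addSn add0n (factS n) (factS (2 * n).+2) (factS (2 * n).+1).
move: (2 * n).+1`! n`! f0 => F G f0; rewrite !natrM !exprS -!natr1 natrM; field.
have k (j : nat) : 2 * n%:R + j.+1%:R != 0 :> R.
  by rewrite -natrM -natrD pnatr_eq0 addnS.
by have := k 1%N; have := k 2; rewrite f0 -!natr1 !add0r !addrA => -> ->.
Qed.

(** By Rodrigues' formula, l integrations by parts move all derivatives onto [q]. As deg q <= l, its
    l-th derivative is the constant l! q_l, so only the top coefficient of [q] matters. *)
Lemma J_legendre (l : nat) q : (size q <= l.+1)%N ->
  J (legendre l * q) = q`_l * J ((1 - 'X ^+ 2) ^+ l) / 2 ^+ l.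
Proof.
move=> sq; have l0 : (l`!)%:R != 0 :> R by rewrite pnatr_eq0 -lt0n fact_gt0.
have -> : legendre l * q =
   (2 ^+ l * (l`!)%:R)^-1 *: ((('X ^+ 2 - 1) ^+ l)^`(l) * q) by rewrite scalerAl.
rewrite JZ J_by_parts; last first.
  by move=> j jl; rewrite -[_ ^+ l]mulr1; exact: derivn_XX1_exp_root.
have -> : q^`(l) = (q`_l *+ l`!)%:P.
  apply/polyP => -[|i]; rewrite coef_derivn coefC/=; first by rewrite addn0 ffactnn.
  by rewrite nth_default ?mul0rn// addnS (leq_trans sq)// ltnS leq_addr.
rewrite [_ * _%:P]mulrC mul_polyC JZ -[_ - 1](opprB 1) (exprNn (1 - _)).
rewrite signr_mulZ.
rewrite JZ -[q`_l *+ _]mulr_natr; move: l`! l0 (J _) => F F0 v.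
(* One sign comes from the integrations by parts, the other from replacing X^2-1 by 1-X^2; they
   cancel. *)
have s1 : (-1) ^+ l * (-1) ^+ l = 1 :> R by rewrite -exprMn mulrNN mulr1 expr1n.
transitivity ((-1) ^+ l * (-1) ^+ l * (q`_l * v / 2 ^+ l)); last by rewrite s1 mul1r.
have e0 : 2 ^+ l != 0 :> R by rewrite expf_neq0.
move: (2 ^+ l) e0 ((-1) ^+ l) => E e0 s {s1}.
by field; rewrite F0 e0.
Qed.

(** With p = (1-X^2)^m P_k^(m), the factor (1-X^2)^m kills the boundary terms of m integrations by
    parts, leaving the integral of P_l against p^(m), a polynomial of degree at most k. [J_legendre]
    then reads off its coefficient of index l, which is 0 if k < l. The falling factorials encode
    (l+m)!/(l-m)! and vanish by themselves when m > l. *)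
Lemma J_assoc_legendre (m l k : nat) : (k <= l)%N ->
  J ((1 - 'X ^+ 2) ^+ m * (legendre k)^`(m) * (legendre l)^`(m)) =
  if k == l then 2 / (2 * l).+1%:R * (l ^_ m)%:R * ((l + m) ^_ m)%:R else 0.
Proof.
move=> kl; set p := _ * (legendre k)^`(m).
have sk : (size ((legendre k)^`(m) : {poly R}) <= k.+1 - m)%N.
  apply: size_derivn; apply: leq_trans (size_legendre k) _; lia.
have [sV cV] := coefX_top m size_1XX.
have sp : (size p <= k.+1 + m)%N.
  have [mk|km] := leqP m k.
    apply: leq_trans (size_polyMleq _ _) _; rewrite -subn1.
    by apply: leq_trans (leq_sub2r 1 (leq_add sV sk)) _; lia.
  by rewrite /p [(legendre k)^`(m)]derivn_poly0 ?mulr0 ?size_poly0// (leq_trans (size_legendre _)).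
have sp' : (size p^`(m) <= k.+1)%N by exact: size_derivn.
have -> : J (p * (legendre l)^`(m)) = (-1) ^+ m * J (legendre l * p^`(m)).
  rewrite [legendre l * _]mulrC (J_by_parts (p := p)); last first.
    move=> j jm; rewrite /p -opprB exprNn -mulrA signr_mulZ derivnZ !hornerZ.
    by have [-> ->] := derivn_XX1_exp_root (legendre k)^`(m) jm; rewrite mulr0.
  by rewrite mulrA -exprMn mulrNN mulr1 expr1n mul1r.
rewrite J_legendre ?(leq_trans sp')//.
have [kE|kNl] := eqVneq k l; last first.
  rewrite [_`_l]nth_default; first by rewrite !mul0r mulr0.
  by rewrite (leq_trans sp')// ltn_neqAle kNl.
subst k; have [ml|lm] := leqP m l; last first.
  rewrite /p [(legendre l)^`(m)]derivn_poly0 ?(leq_trans (size_legendre _))//.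
  by rewrite mulr0 coef_derivn coef0 mul0rn !mul0r mulr0 ffact_small// mulr0 mul0r.
have -> : (p^`(m))`_l = (-1) ^+ m * (legendre l)`_l * (l ^_ m)%:R * ((l + m) ^_ m)%:R.
  have lE : (m + l = m * 2 + (l - m))%N by lia.
  rewrite coef_derivn lE coefM_top//; last by lia.
  rewrite cV coef2_1XX coef_derivn subnKC//. by rewrite -lE (addnC m l) !mulr_natr mulrnAr.
rewrite J_1XX_exp coef_legendre factS natrM.
have l0 : (l`!)%:R != 0 :> R by rewrite pnatr_eq0 -lt0n fact_gt0.
have ll0 : ((2 * l)`!)%:R != 0 :> R by rewrite pnatr_eq0 -lt0n fact_gt0.
have l10 : (2 * l).+1%:R != 0 :> R by rewrite pnatr_eq0.
have -> : 2 ^+ (2 * l).+1 = 2 * 2 ^+ l * 2 ^+ l :> R.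
  by rewrite exprS mul2n -addnn exprD mulrA.
have e0 : 2 ^+ l != 0 :> R by rewrite expf_neq0.
have s1 : (-1) ^+ m * (-1) ^+ m = 1 :> R by rewrite -exprMn mulrNN mulr1 expr1n.
rewrite -[RHS]mul1r -[X in _ = X * _]s1.
move: ((-1) ^+ m) (2 ^+ l) e0 (l ^_ m) ((l + m) ^_ m) l`! (2 * l)`! (2 * l).+1 l0 ll0 l10.
move=> s E e0 a b c d e l0 ll0 l10 {s1}.
by field; rewrite l0 ll0 l10 e0.
Qed.
End AssociatedLegendre.

                                  

(** * Integration on the sphere in spherical coordinates *)

Section Density.
Context {R : realType} d d' (X : measurableType d) (Y : measurableType d').
Variables (m : {measure set X -> \bar R}) (nu : {measure set Y -> \bar R}).
Variables (D : set X) (h : X -> R) (phi : X -> Y).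
Hypotheses (mD : measurable D) (mh : measurable_fun D h).
Hypothesis h0 : forall x, D x -> 0 <= h x.
Hypothesis mphi : measurable_fun setT phi.
Hypothesis nuE : forall A, measurable A ->
  nu A = (\int[m]_(x in D `&` phi @^-1` A) (h x)%:E)%E.

Import HBNNSimple.

(** Change of variables for the image under [phi] of the measure with density [h]: the identity
    holds for indicators by [nuE], hence for simple functions, and monotone convergence along
    [nnsfun_approx] does the rest. *)
Lemma ge0_integral_density (f : Y -> \bar R) : measurable_fun setT f ->
  (forall y, 0 <= f y)%E ->
  (\int[nu]_y f y = \int[m]_(x in D) ((h x)%:E * f (phi x)))%E.
Proof.
move=> mf f0; pose f_ := nnsfun_approx measurableT mf.
have cf y : (fun n => (f_ n y)%:E) @ \oo --> f y by exact: cvg_nnsfun_approx.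
have ndf y (a b : nat) : (a <= b)%N -> ((f_ a y)%:E <= (f_ b y)%:E)%E.
  by move=> ab; rewrite lee_fin; exact/lefP/nd_nnsfun_approx.
have mfphi n : measurable_fun D (fun x => f_ n (phi x)).
  by apply/measurable_funTS; exact: measurableT_comp.
have mpre (A : set Y) : measurable A -> measurable (phi @^-1` A).
  by move=> mA; rewrite -[_ @^-1` _]setTI; exact: mphi.
transitivity (limn (fun n => (\int[nu]_y (f_ n y)%:E)%E)).
  rewrite -monotone_convergence//.
  - by apply: eq_integral => y _; apply/esym/cvg_lim.
  - by move=> n; exact/measurable_EFinP.
  - by move=> n y _; rewrite lee_fin.
  - by move=> y _ a b; exact: ndf.
transitivity (limn (fun n => (\int[m]_(x in D) ((h x)%:E * (f_ n (phi x))%:E))%E));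
    last first.
  rewrite -monotone_convergence//.
  - apply: eq_integral => x /[!inE] Dx; apply/cvg_lim => //.
    by apply: cvgeZl => //; exact: cf.
  - by move=> n; apply: emeasurable_funM; exact/measurable_EFinP.
  - by move=> n x Dx; rewrite mule_ge0 ?lee_fin ?h0.
  - by move=> x Dx a b ab; apply: lee_wpmul2l; [by rewrite lee_fin h0|exact: ndf].
congr (limn _); apply/funext => n.
have mk k : measurable (f_ n @^-1` [set k]) by [].
transitivity (\sum_(k \in range (f_ n)) (k%:E * nu (f_ n @^-1` [set k]))%E).
  by rewrite integral_nnsfun// patch_setT sintegralE.
have mind k : measurable_fun D (fun x => \1_(f_ n @^-1` [set k]) (phi x) : R).
  by apply/measurable_funTS; exact: measurableT_comp.
transitivity (\sum_(k \in range (f_ n)) (\int[m]_(x in D)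
    ((h x)%:E * (k * \1_(f_ n @^-1` [set k]) (phi x))%:E))%E).
  apply: eq_fsbigr => k /[!inE] -[y _ <-].
  under eq_integral do rewrite EFinM muleCA.
  rewrite ge0_integralZl ?lee_fin//; last 2 first.
  - by apply: emeasurable_funM; exact/measurable_EFinP.
  - by move=> x Dx; rewrite mule_ge0 ?lee_fin ?h0// indicE.
  congr (_ * _)%E; rewrite nuE// integral_mkcondr; apply: eq_integral => x _.
  rewrite patchE indicE -[x \in _]/(phi x \in f_ n @^-1` _).
  by case: ifPn; rewrite ?mule1 ?mule0.
rewrite -ge0_integral_fsum//.
- apply: eq_integral => x Dx; rewrite -ge0_mule_fsumr.
    by rewrite fsumEFin// -fimfunE.
  by move=> k; exact: nnfun_muleindic_ge0.
- move=> k; apply: emeasurable_funM; apply/measurable_EFinP => //.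
  exact: measurable_funM.
- by move=> k x Dx; rewrite mule_ge0 ?lee_fin ?h0//; exact: nnfun_muleindic_ge0.
Qed.
End Density.

Section SphereIntegral.
Context {R : realType}.
Implicit Types (p : R * R) (x : 3.-tuple R).

Lemma measurable_sphere : measurable (@sphere R).
Proof.
rewrite [X in measurable X](_ : _ =
  (fun x : 3.-tuple R => \sum_(i < 3) tnth x i ^+ 2) @^-1` [set 1])//.
rewrite -[X in measurable X]setTI.
have : measurable_fun setT (fun x : 3.-tuple R => \sum_(i < 3) tnth x i ^+ 2).
  apply: measurable_sum => i; apply: measurable_funX; exact: measurable_tnth.
by apply => //; exact: measurable_set1.
Qed.

Lemma spherical_sphere p : sphere (spherical p).
Proof.
rewrite /sphere /spherical/= !big_ord_recr big_ord0/= !(tnth_nth 0)/= add0r.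
by rewrite !exprMn -mulrDr cos2Dsin2 mulr1 addrC cos2Dsin2.
Qed.

(** Extend [f] by 0 off the sphere, apply the density formula, then Tonelli on the rectangle. The
    extension becomes invisible because [spherical] takes all its values on the sphere. *)
Lemma ge0_integral_sphere (f : 3.-tuple R -> \bar R) :
  measurable_fun sphere f -> (forall x, sphere x -> 0 <= f x)%E ->
  (\int[@sphere_measure R]_(x in sphere) f x =
   \int[lebesgue_measure]_(th in `[0%R, pi]) \int[lebesgue_measure]_(ph in `[0%R, (2 * pi)%R])
     ((sin th / (4 * pi))%:E * f (spherical (th, ph))))%E.
Proof.
move=> mf f0; have mS := measurable_sphere.
have mfS : measurable_fun setT (f \_ sphere) by apply/(measurable_restrictT f mS).
have f0S y : (0 <= (f \_ sphere) y)%E.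
  by rewrite patchE; case: ifPn => // /[!inE] yS; exact: f0.
have mdens (D : set (R * R)) : measurable_fun D (fun p => sin p.1 / (4 * pi)).
  apply: measurable_funM => //; apply: measurable_funTS.
  apply: measurableT_comp; last exact: measurable_fst.
  by apply: continuous_measurable_fun; exact: continuous_sin.
have dens0 p : spherical_dom p -> 0 <= sin p.1 / (4 * pi) :> R.
  move=> [/= p1 _]; rewrite divr_ge0 ?mulr_ge0 ?pi_ge0//.
  by apply: sin_ge0_pi; move: p1; rewrite in_itv.
rewrite integral_mkcond (@ge0_integral_density _ _ _ _ _
  (@lebesgue_measure R \x @lebesgue_measure R)%E (@sphere_measure R) spherical_dom
  (fun p => sin p.1 / (4 * pi)) spherical measurable_spherical_dom (mdens _) dens0
  measurable_spherical)//.
have mF : measurable_fun spherical_dom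
   (fun p => (sin p.1 / (4 * pi))%:E * (f \_ sphere) (spherical p))%E.
  apply: emeasurable_funM; first exact/measurable_EFinP.
  by apply: measurable_funTS; apply: measurableT_comp => //; exact: measurable_spherical.
rewrite integral_mkcond fubini_tonelli1; last 2 first.
- by apply/(measurable_restrictT _ measurable_spherical_dom).
- by move=> p; rewrite patchE; case: ifPn => // /[!inE] /dens0 ?; rewrite mule_ge0.
rewrite [RHS]integral_mkcond; apply: eq_integral => th _; rewrite /fubini_F patchE.
case: ifPn => [/[!inE] thI|/negP thI].
  rewrite [RHS]integral_mkcond; apply: eq_integral => ph _; rewrite !patchE.
  rewrite (_ : ((th, ph) \in spherical_dom) = (ph \in `[0, (2 * pi)%R]%classic)).
    by case: ifP => // _; rewrite ifT// inE; exact: spherical_sphere.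
  by apply/idP/idP => /[!inE]; [case|split].
apply: integral0_eq => ph _; rewrite patchE ifF//.
by apply/negP => /[!inE] -[/= thI' _]; apply: thI; rewrite inE.
Qed.

End SphereIntegral.

                                                              

(** * Orthogonal families in one variable: trigonometric and Legendre functions *)

Section OrthogonalFamilies.
Context {R : realType}.
Implicit Types (f g F rho : R -> R) (p q : {poly R}) (a b : R).

Lemma continuous_itv_integrable f a b : continuous f ->
  (@lebesgue_measure R).-integrable `[a, b] (EFin \o f).
Proof.
move=> cf; apply: continuous_compact_integrable; first exact: segment_compact.
exact: continuous_subspaceT.
Qed.

Lemma EFin_Rintegral_itv f a b : continuous f ->
  (\int[lebesgue_measure]_(x in `[a, b]) (f x)%:E)%E =
  (\int[lebesgue_measure]_(x in `[a, b]) f x)%:E.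
Proof.
move=> cf; rewrite /Rintegral fineK//.
exact: (integrable_fin_num _ (continuous_itv_integrable _ _ cf)).
Qed.

Lemma Rintegral_derive F f a b : a < b -> continuous f ->
  (forall x : R, is_derive x 1 F (f x)) ->
  \int[lebesgue_measure]_(x in `[a, b]) f x = F b - F a.
Proof.
move=> ab cf dF; apply: EFin_inj; rewrite -EFin_Rintegral_itv// EFinB.
have cF x : {for x, continuous F}.
  by apply: differentiable_continuous; apply/derivable1_diffP.
rewrite (continuous_FTC2 (F := F) ab)//.
- exact: continuous_subspaceT.
- split=> [x _||]; first by [].
  + by apply: cvg_at_right_filter; exact: cF.
  + by apply: cvg_at_left_filter; exact: cF.
- by move=> x _; rewrite derive1E; exact: derive_val.
Qed.

Lemma continuous_fun_sum (I : Type) (s : seq I) (f : I -> R -> R) :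
  (forall i, continuous (f i)) -> continuous (fun x => \sum_(i <- s) f i x).
Proof. by move=> cf; apply: continuous_big => //; exact: add_continuous. Qed.

Lemma continuous_funM f g : continuous f -> continuous g ->
  continuous (fun x => f x * g x).
Proof. by move=> cf cg x; apply: cvgM; [exact: cf|exact: cg]. Qed.

Lemma continuous_funZ (u : R) f : continuous f -> continuous (fun x => u * f x).
Proof. by move=> cf; apply: continuous_funM => // x; exact: cvg_cst. Qed.

Lemma continuous_fun_comp f g : continuous f -> continuous g ->
  continuous (fun x => g (f x)).
Proof. by move=> cf cg x; exact: continuous_comp (cf x) (cg _). Qed.

Lemma Rintegral_itv_sum (I : Type) (s : seq I) (f : I -> R -> R) a b :
  (forall i, continuous (f i)) ->
  \int[lebesgue_measure]_(x in `[a, b]) (\sum_(i <- s) f i x) =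
  \sum_(i <- s) \int[lebesgue_measure]_(x in `[a, b]) f i x.
Proof.
move=> cf; apply: EFin_inj.
rewrite -EFin_Rintegral_itv; last exact: continuous_fun_sum.
rewrite -sumEFin; under eq_bigr do rewrite -EFin_Rintegral_itv//.
under eq_integral do rewrite -sumEFin.
by rewrite integral_sum// => i; exact: (continuous_itv_integrable _ _ (cf i)).
Qed.

(** Pythagoras for a finite family orthogonal with respect to the density [rho]. It is used twice:
    for the trigonometric system with density 1, and for Legendre functions of cos with density
    sin. *)
Lemma integral_itv_sqr_sum (I : finType) (f : I -> R -> R) rho (w c : I -> R) a b :
  (forall i, continuous (f i)) -> continuous rho ->
  (forall i j, \int[lebesgue_measure]_(x in `[a, b]) (f i x * f j x * rho x) =
    if i == j then w i else 0) ->
  (\int[lebesgue_measure]_(x in `[a, b])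
     ((\sum_i c i * f i x) ^+ 2 * rho x)%:E)%E = (\sum_i c i ^+ 2 * w i)%:E.
Proof.
move=> cf crho fE.
have cfij i j : continuous (fun x => f i x * f j x * rho x).
  by apply: continuous_funM => //; exact: continuous_funM.
have cfc (u : R) i j : continuous (fun x => u * (f i x * f j x * rho x)).
  exact: continuous_funZ.
rewrite EFin_Rintegral_itv; last first.
  under eq_fun do rewrite expr2.
  apply: continuous_funM => //; apply: continuous_funM;
  by apply: continuous_fun_sum => i; exact: continuous_funZ.
congr EFin.
transitivity (\int[lebesgue_measure]_(x in `[a, b])
    (\sum_i \sum_j c i * c j * (f i x * f j x * rho x))).
  apply: eq_Rintegral => x _; rewrite expr2 big_distrlr/= mulr_suml.
  by apply: eq_bigr => i _; rewrite mulr_suml; apply: eq_bigr => j _; ring.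
rewrite Rintegral_itv_sum; last by move=> i; exact: continuous_fun_sum.
apply: eq_bigr => i _; rewrite Rintegral_itv_sum; last by move=> j; exact: cfc.
have E j : \int[lebesgue_measure]_(x in `[a, b]) (c i * c j * (f i x * f j x * rho x)) =
   c i * c j * (if i == j then w i else 0).
  by rewrite RintegralZl ?fE//; exact: continuous_itv_integrable.
under eq_bigr do rewrite E.
rewrite (bigD1 i)//= eqxx big1 ?addr0 ?expr2// => j /negbTE.
by rewrite eq_sym => ->; rewrite mulr0.
Qed.

Definition trig (i : nat * bool) (x : R) : R :=
  if i.2 then sin (i.1%:R * x) else cos (i.1%:R * x).

Lemma continuous_trig i : continuous (trig i).
Proof.
have c : continuous (fun y : R => i.1%:R * y).
  by apply: continuous_funZ => y; exact: cvg_id.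
move=> x; rewrite /trig.
case: i.2.
  by apply: continuous_comp; [exact: c|exact: continuous_sin].
by apply: continuous_comp; [exact: c|exact: continuous_cos].
Qed.

Lemma cos_sin_int2pi (k : int) :
  cos (k%:~R * (2 * pi)) = 1 :> R /\ sin (k%:~R * (2 * pi)) = 0 :> R.
Proof.
have E (n : nat) : n%:R * (2 * pi) = 0 + pi *+ 2 *+ n :> R.
  by rewrite add0r [LHS]mulr_natl (mulr_natl pi 2).
case: k => n; first by rewrite -pmulrn E !periodicn ?cos0 ?sin0//;
  [exact: sinD2pi|exact: cosD2pi].
rewrite NegzE mulrNz mulNr cosN sinN -pmulrn E !periodicn ?cos0 ?sin0 ?oppr0//.
- exact: sinD2pi.
- exact: cosD2pi.
Qed.

Lemma is_derive_mull (u x : R) : is_derive x 1 (fun y : R => u * y) u.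
Proof.
have := @is_deriveM R R (cst u) id x 1 0 1 (is_derive_cst _ _ _) (is_derive_id _ _).
rewrite (_ : cst u * id = (fun y : R => u * y))// => dM.
by move: dM; rewrite scaler0 addr0 -[_%:A]/(u * 1) mulr1.
Qed.

Lemma is_derive_scale_comp_mull (f : R -> R) (u v x a : R) :
  is_derive (u * x) 1 f a ->
  is_derive x 1 (fun y : R => v * f (u * y)) (v * (a * u)).
Proof.
move=> df; have dg := is_derive1_comp df (is_derive_mull u x).
have := is_derive1_comp (is_derive_mull v (f (u * x))) dg.
by rewrite (_ : _ \o (f \o _) = (fun y : R => v * f (u * y))).
Qed.

Lemma Rintegral_cos_int (k : int) :
  \int[lebesgue_measure]_(x in `[0, 2 * pi]) cos (k%:~R * x) =
  if k == 0 then 2 * pi else 0 :> R.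
Proof.
have pi2 : 0 < 2 * pi :> R by rewrite mulr_gt0 ?pi_gt0.
have cc : continuous (fun x : R => cos (k%:~R * x)).
  move=> x; apply: continuous_comp; last exact: continuous_cos.
  by apply: continuous_funZ => y; exact: cvg_id.
case: eqVneq => [k0|k0].
  have dF (x : R) : is_derive x 1 (id : R -> R) (cos (k%:~R * x)).
    by rewrite k0 mul0r cos0; exact: is_derive_id.
  by rewrite (Rintegral_derive pi2 cc dF) subr0.
have k1 : k%:~R != 0 :> R by rewrite intr_eq0.
have dF (x : R) : is_derive x 1 (fun x : R => k%:~R^-1 * sin (k%:~R * x)) (cos (k%:~R * x)).
  have := is_derive_scale_comp_mull k%:~R^-1 (is_derive_sin (k%:~R * x)).
  by rewrite mulrCA mulVf// mulr1.
by rewrite (Rintegral_derive pi2 cc dF) (cos_sin_int2pi k).2 !mulr0 sin0 mulr0 subrr.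
Qed.

Lemma Rintegral_sin_int (k : int) :
  \int[lebesgue_measure]_(x in `[0, 2 * pi]) sin (k%:~R * x) = 0 :> R.
Proof.
have pi2 : 0 < 2 * pi :> R by rewrite mulr_gt0 ?pi_gt0.
have [->|k0] := eqVneq k 0.
  under eq_Rintegral do rewrite mul0r sin0.
  by rewrite Rintegral_cst// mul0r.
have k1 : k%:~R != 0 :> R by rewrite intr_eq0.
have cs : continuous (fun x : R => sin (k%:~R * x)).
  move=> x; apply: continuous_comp; last exact: continuous_sin.
  by apply: continuous_funZ => y; exact: cvg_id.
have dF (x : R) : is_derive x 1 (fun x : R => - k%:~R^-1 * cos (k%:~R * x)) (sin (k%:~R * x)).
  have := is_derive_scale_comp_mull (- k%:~R^-1) (is_derive_cos (k%:~R * x)).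
  by rewrite mulrA mulrNN mulrC mulrA divff// mul1r.
by rewrite (Rintegral_derive pi2 cs dF) (cos_sin_int2pi k).1 !mulr0 cos0 subrr.
Qed.

(** Squared norms of the trigonometric system on a period; the sine of frequency 0 is the zero
    function, whence the weight 0. *)
Definition trig_weight (i : nat * bool) : R :=
  if i.1 == 0%N then (if i.2 then 0 else 2 * pi) else pi.

(** Product-to-sum formulas reduce the integral to frequencies m-n and m+n, taken in [int] since the
    difference may be negative. The trailing factor 1 is the density expected by
    [integral_itv_sqr_sum]. *)
Lemma Rintegral_trig (i j : nat * bool) :
  \int[lebesgue_measure]_(x in `[0, 2 * pi]) (trig i x * trig j x * 1) =
  if i == j then trig_weight i else 0.
Proof.
case: i j => [m b] [n c]; rewrite /trig /trig_weight/=.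
have ci (k : int) : (@lebesgue_measure R).-integrable `[0, 2 * pi]
    (EFin \o (fun x : R => 2^-1 * cos (k%:~R * x))).
  apply: continuous_itv_integrable; apply: continuous_funZ => x.
  apply: continuous_comp; last exact: continuous_cos.
  by apply: continuous_funZ => y; exact: cvg_id.
have si (k : int) : (@lebesgue_measure R).-integrable `[0, 2 * pi]
    (EFin \o (fun x : R => 2^-1 * sin (k%:~R * x))).
  apply: continuous_itv_integrable; apply: continuous_funZ => x.
  apply: continuous_comp; last exact: continuous_sin.
  by apply: continuous_funZ => y; exact: cvg_id.
have ci' (k : int) : (@lebesgue_measure R).-integrable `[0, 2 * pi]
    (EFin \o (fun x : R => cos (k%:~R * x))).
  apply: continuous_itv_integrable => x.
  apply: continuous_comp; last exact: continuous_cos.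
  by apply: continuous_funZ => y; exact: cvg_id.
have si' (k : int) : (@lebesgue_measure R).-integrable `[0, 2 * pi]
    (EFin \o (fun x : R => sin (k%:~R * x))).
  apply: continuous_itv_integrable => x.
  apply: continuous_comp; last exact: continuous_sin.
  by apply: continuous_funZ => y; exact: cvg_id.
pose dif := m%:Z - n%:Z; pose sm := m%:Z + n%:Z.
have difE (x : R) : dif%:~R * x = m%:R * x - n%:R * x by rewrite /dif intrB mulrBl.
have smE (x : R) : sm%:~R * x = m%:R * x + n%:R * x by rewrite /sm intrD mulrDl.
have dif0 : (dif == 0) = (m == n) by rewrite subr_eq0.
have sm0 : (sm == 0) = (m == 0%N) && (n == 0%N) by rewrite /sm -PoszD eqz_nat addn_eq0.
have mn0 : m != n -> (m == 0%N) && (n == 0%N) = false.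
  by apply: contraNF => /andP[/eqP -> /eqP ->].
case: b; case: c; rewrite xpair_eqE/= ?andbT ?andbF.
- transitivity (\int[lebesgue_measure]_(x in `[0, 2 * pi])
     (2^-1 * cos (dif%:~R * x) - 2^-1 * cos (sm%:~R * x)) : R).
    by apply: eq_Rintegral => x _; rewrite difE smE cosB cosD; field.
  rewrite RintegralB// !RintegralZl// !Rintegral_cos_int dif0 sm0.
  have [<-|/mn0 ->] := eqVneq m n; last by rewrite subrr.
  by rewrite andbb; case: ifP => _; field.
- transitivity (\int[lebesgue_measure]_(x in `[0, 2 * pi])
     (2^-1 * sin (sm%:~R * x) + 2^-1 * sin (dif%:~R * x)) : R).
    by apply: eq_Rintegral => x _; rewrite difE smE sinB sinD; field.
  by rewrite RintegralD// !RintegralZl// !Rintegral_sin_int mulr0 addr0.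
- transitivity (\int[lebesgue_measure]_(x in `[0, 2 * pi])
     (2^-1 * sin (sm%:~R * x) - 2^-1 * sin (dif%:~R * x)) : R).
    by apply: eq_Rintegral => x _; rewrite difE smE sinB sinD; field.
  by rewrite RintegralB// !RintegralZl// !Rintegral_sin_int mulr0 subr0.
- transitivity (\int[lebesgue_measure]_(x in `[0, 2 * pi])
     (2^-1 * cos (dif%:~R * x) + 2^-1 * cos (sm%:~R * x)) : R).
    by apply: eq_Rintegral => x _; rewrite difE smE cosB cosD; field.
  rewrite RintegralD// !RintegralZl// !Rintegral_cos_int dif0 sm0.
  have [<-|/mn0 ->] := eqVneq m n; last by rewrite !mulr0 addr0.
  by rewrite andbb; case: ifP => _; field.
Qed.

(** The integral of [p] over [-1, 1] after substituting x = cos theta; it satisfies the three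
    hypotheses on [J]. *)
Definition polar_int p : R :=
  \int[lebesgue_measure]_(x in `[0, pi]) (p.[cos x] * sin x).

Lemma continuous_polar p : continuous (fun x : R => p.[cos x] * sin x).
Proof.
apply: continuous_funM; last exact: continuous_sin.
move=> x; apply: continuous_comp; first exact: continuous_cos.
exact: continuous_horner.
Qed.

Lemma polar_intB p q : polar_int (p - q) = polar_int p - polar_int q.
Proof.
rewrite /polar_int -RintegralB//.
- by apply: eq_Rintegral => x _; rewrite !hornerE mulrBl.
- by apply: continuous_itv_integrable; exact: continuous_polar.
- by apply: continuous_itv_integrable; exact: continuous_polar.
Qed.

Lemma polar_intZ (u : R) p : polar_int (u *: p) = u * polar_int p.
Proof.
rewrite /polar_int -RintegralZl//.
- by apply: eq_Rintegral => x _; rewrite hornerZ -mulrA.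
- by apply: continuous_itv_integrable; exact: continuous_polar.
Qed.

Lemma polar_int_deriv p : polar_int p^`() = p.[1] - p.[- 1].
Proof.
have dF (x : R) : is_derive x 1 (fun x : R => - p.[cos x]) (p^`().[cos x] * sin x).
  have := is_deriveN (is_derive1_comp (is_derive_poly p (cos x)) (is_derive_cos x)).
  rewrite mulrN opprK.
  by rewrite (_ : - (_ \o _) = (fun x : R => - p.[cos x])).
rewrite /polar_int (Rintegral_derive (pi_gt0 R) _ dF); last exact: continuous_polar.
by rewrite cospi cos0 opprK addrC.
Qed.

(** The two factors sqrt(1-x^2)^m multiply to the polynomial (1-x^2)^m and the signs (-1)^m cancel,
    so the integrand is the one of [J_assoc_legendre] at x = cos theta. The symmetry in l and k
    removes the restriction k <= l. *)
Lemma Rintegral_assoc_legendre (m l k : nat) :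
  \int[lebesgue_measure]_(x in `[0, pi])
    (assoc_legendre_nat l m (cos x) * assoc_legendre_nat k m (cos x) * sin x) =
  if l == k then 2 / (2 * l).+1%:R * (l ^_ m)%:R * ((l + m) ^_ m)%:R else 0 :> R.
Proof.
pose w i : R := 2 / (2 * i).+1%:R * (i ^_ m)%:R * ((i + m) ^_ m)%:R.
rewrite -/(w l); wlog kl : l k / (k <= l)%N => [hw|].
  have [kl|/ltnW lk] := leqP k l; first exact: hw.
  have <- : (if k == l then w k else 0) = (if l == k then w l else 0) :> R.
    by rewrite eq_sym; case: eqP => [->|].
  by rewrite -hw//; apply: eq_Rintegral => x _; rewrite [assoc_legendre_nat k _ _ * _]mulrC.
rewrite eq_sym /w {w}.
rewrite -(J_assoc_legendre polar_intB polar_intZ polar_int_deriv m kl).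
apply: eq_Rintegral => x _; congr (_ * _); rewrite /assoc_legendre_nat.
rewrite !hornerM !horner_exp !hornerE /=.
have : Num.sqrt (1 - cos x ^+ 2) ^+ 2 = 1 - cos x ^+ 2.
  rewrite sqr_sqrtr// subr_ge0 -(cos2Dsin2 x) lerDl; exact: sqr_ge0.
move: (Num.sqrt _) => s <-; rewrite -exprM mulnC exprM expr2.
have : (- 1) ^+ m * (- 1) ^+ m = 1 :> R by rewrite -exprMn mulrNN mulr1 expr1n.
move: ((- 1) ^+ m) (s ^+ m) => u v uu.
by rewrite -[RHS]mul1r -uu; ring.
Qed.
End OrthogonalFamilies.

                            

(** * Spherical harmonics in coordinates and Parseval's identity on the sphere *)

Section SphericalHarmonics.
Context {R : realType}.
Implicit Types (x : 3.-tuple R) (p : R * R) (i : nat * bool).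

Lemma tnth_spherical p :
  [/\ tnth (spherical p) (inord 0) = sin p.1 * cos p.2,
      tnth (spherical p) (inord 1) = sin p.1 * sin p.2 &
      tnth (spherical p) (inord 2) = cos p.1].
Proof. by split; rewrite (tnth_nth 0) inordK. Qed.

Lemma sphereE x : sphere x ->
  tnth x (inord 0) ^+ 2 + tnth x (inord 1) ^+ 2 + tnth x (inord 2) ^+ 2 = 1.
Proof.
rewrite /sphere/= !big_ord_recr big_ord0/= add0r => <-.
by congr (_ ^+ 2 + _ ^+ 2 + _ ^+ 2); congr tnth; apply/val_inj; rewrite /= inordK.
Qed.

Lemma sqr_le1_itv (a : R) : a ^+ 2 <= 1 -> -1 <= a <= 1.
Proof. by move=> a1; apply/andP; split; nra. Qed.

Lemma cos_colatitude x : sphere x -> cos (colatitude x) = tnth x (inord 2).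
Proof.
move=> /sphereE xS; rewrite /colatitude acosK// in_itv/=.
by apply: sqr_le1_itv; rewrite -xS lerDr addr_ge0// sqr_ge0.
Qed.

(** Away from the poles (a/rho, b/rho) lies on the unit circle, and the sign of b selects the branch
    of [acos]. At the poles the longitude is 0: the cosine needs its own value 1, while b / 0 = 0
    already is the right sine. *)
Lemma cos_sin_longitude x :
  let a := tnth x (inord 0) in let b := tnth x (inord 1) in
  let rho := Num.sqrt (a ^+ 2 + b ^+ 2) in
  cos (longitude x) = (if rho == 0 then 1 else a / rho) /\
  sin (longitude x) = b / rho.
Proof.
rewrite /longitude; move: (tnth x (inord 0)) (tnth x (inord 1)) => a b.
case: ifPn => [/eqP ->|r0]; first by rewrite cos0 sin0 invr0 mulr0.
have ab0 : 0 <= a ^+ 2 + b ^+ 2 by rewrite addr_ge0// sqr_ge0.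
pose r := Num.sqrt (a ^+ 2 + b ^+ 2).
have rE : r ^+ 2 = a ^+ 2 + b ^+ 2 by exact: sqr_sqrtr.
have rge0 : 0 <= r by exact: sqrtr_ge0.
rewrite -/r in r0 *; move: r r0 rE rge0 => r r0 rE rge0.
have r2 : r ^+ 2 != 0 by rewrite expf_neq0.
have ar : (a / r) ^+ 2 = 1 - (b / r) ^+ 2.
  by rewrite !expr_div_n rE in r2 *; field.
have ar1 : -1 <= a / r <= 1.
  by apply: sqr_le1_itv; rewrite ar lerBlDr lerDl sqr_ge0.
have sE : sin (acos (a / r)) = `|b / r|.
  by rewrite sin_acos// ar opprB addrCA subrr addr0 sqrtr_sqr.
have cE : cos (acos (a / r)) = a / r by rewrite acosK// in_itv.
have p2 : 2 * pi = pi *+ 2 :> R by rewrite mulr_natl.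
case: ifPn => [b0|]; first by rewrite cE sE ger0_norm// divr_ge0.
rewrite -ltNge => b0.
rewrite p2 addrC cosD2pi sinD2pi cosN sinN cE sE ler0_norm ?opprK//.
by rewrite mulr_le0_ge0 ?ltW// invr_gt0 lt_def r0.
Qed.

(** cos(ny) and sin(ny) are polynomials in cos y and sin y. So [longitude] may be replaced by the
    original angle without showing that the two agree modulo 2 pi. *)
Lemma eq_cos_sin_natmul (y z : R) (n : nat) : cos y = cos z -> sin y = sin z ->
  cos (n%:R * y) = cos (n%:R * z) /\ sin (n%:R * y) = sin (n%:R * z).
Proof.
move=> cE sE; elim: n => [|n [IHc IHs]]; first by rewrite !mul0r.
by rewrite -natr1 !mulrDl !mul1r !cosD !sinD IHc IHs cE sE.
Qed.

Lemma trig_longitude i p : 0 < sin p.1 ->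
  trig i (longitude (spherical p)) = trig i p.2.
Proof.
move=> s0; have [cE sE] := cos_sin_longitude (spherical p).
have [t0 t1 _] := tnth_spherical p.
have rE : Num.sqrt ((sin p.1 * cos p.2) ^+ 2 + (sin p.1 * sin p.2) ^+ 2) = sin p.1.
  by rewrite !exprMn -mulrDr cos2Dsin2 mulr1 sqrtr_sqr gtr0_norm.
move: cE sE; rewrite t0 t1 rE gt_eqF// ![sin p.1 * _]mulrC !mulfK ?gt_eqF//.
move=> cE sE; have [cn sn] := eq_cos_sin_natmul i.1 cE sE.
by rewrite /trig cn sn.
Qed.

Lemma measurable_coord (k : 'I_3) : measurable_fun setT (fun x => tnth x k).
Proof. exact: measurable_tnth. Qed.

(** The cosine and sine of the longitude are explicit measurable functions of the coordinates; the
    addition formulas extend measurability to every frequency. *)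
Lemma measurable_trig_longitude i : measurable_fun setT (fun x => trig i (longitude x)).
Proof.
pose rho x := Num.sqrt (tnth x (inord 0) ^+ 2 + tnth x (inord 1) ^+ 2).
have mr : measurable_fun setT rho.
  apply: (measurableT_comp (f := @Num.sqrt R)).
    by apply: continuous_measurable_fun; exact: sqrt_continuous.
  by apply: measurable_funD; apply: measurable_funX; exact: measurable_coord.
have mV : measurable_fun setT (fun x => (rho x)^-1).
  (* Inversion is seen as a real power; as [rho] is nonnegative the two agree, also at 0. *)
  rewrite (_ : (fun x => _) = (fun x => rho x `^ (- 1))).
    by apply: (measurableT_comp (f := @powR R ^~ (- 1))) => //; exact: measurable_powR.
  by apply/funext => x; rewrite powR_inv1// sqrtr_ge0.
have mb : measurable_fun setT (fun x => tnth x (inord 1) / rho x).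
  by apply: measurable_funM => //; exact: measurable_coord.
have ma : measurable_fun setT (fun x => if rho x == 0 then 1 else tnth x (inord 0) / rho x).
  apply: measurable_fun_ifT => //; first exact: measurable_fun_eqr.
  by apply: measurable_funM => //; exact: measurable_coord.
have mcs (n : nat) : measurable_fun setT (fun x => cos (n%:R * longitude x)) /\
    measurable_fun setT (fun x => sin (n%:R * longitude x)).
  have mc : measurable_fun setT (fun x => cos (longitude x)).
    by under eq_fun do rewrite (cos_sin_longitude _).1.
  have ms : measurable_fun setT (fun x => sin (longitude x)).
    by under eq_fun do rewrite (cos_sin_longitude _).2.
  elim: n => [|n [IHc IHs]].
    under eq_fun do rewrite mul0r cos0.
    by under [X in _ /\ measurable_fun _ X]eq_fun do rewrite mul0r sin0.
  split; under eq_fun do rewrite -natr1 mulrDl mul1r ?cosD ?sinD.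
    by apply: measurable_funB; exact: measurable_funM.
  by apply: measurable_funD; exact: measurable_funM.
by rewrite /trig; case: i.2; [exact: (mcs _).2|exact: (mcs _).1].
Qed.

(** The colatitude factor of the harmonic: Y_{l,m} = [norm_legendre l m (cos theta)] e^{i m phi} for
    0 <= m <= l. *)
Definition norm_legendre (l m : nat) (z : R) : R :=
  Num.sqrt ((2 * l + 1)%:R * (l - m)`!%:R / (l + m)`!%:R) *
  assoc_legendre_nat l m z.

Lemma continuous_assoc_legendre_nat l m : continuous (@assoc_legendre_nat R l m).
Proof.
apply: continuous_funM; last exact: continuous_horner.
apply: continuous_funZ.
apply: (@continuous_fun_comp _ (fun z => Num.sqrt (1 - z ^+ 2)) (fun y => y ^+ m));
  last exact: exprn_continuous.
apply: (@continuous_fun_comp _ (fun z => 1 - z ^+ 2) Num.sqrt);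
  last exact: sqrt_continuous.
by move=> z; apply: cvgB; [exact: cvg_cst|exact: exprn_continuous].
Qed.

Lemma continuous_norm_legendre l m : continuous (norm_legendre l m).
Proof. by apply: continuous_funZ; exact: continuous_assoc_legendre_nat. Qed.

(** For m <= l the normalisation cancels (l+m)!/(l-m)! and 2l+1, leaving 2, the length of [-1, 1].
    For m > l the function is zero, which the factor [(m <= l)%N%:R] records. *)
Lemma Rintegral_norm_legendre (m l k : nat) :
  \int[lebesgue_measure]_(x in `[0, pi])
    (norm_legendre l m (cos x) * norm_legendre k m (cos x) * sin x) =
  if l == k then (m <= l)%N%:R * 2 else 0 :> R.
Proof.
rewrite /norm_legendre.
set a := Num.sqrt _; set b := Num.sqrt _.
transitivity (\int[lebesgue_measure]_(x in `[0, pi]) (a * b *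
    (assoc_legendre_nat l m (cos x) * assoc_legendre_nat k m (cos x) * sin x))).
  by apply: eq_Rintegral => x _; ring.
rewrite RintegralZl//; last first.
  apply: continuous_itv_integrable; apply: continuous_funM; last exact: continuous_sin.
  by apply: continuous_funM; apply: (@continuous_fun_comp _ cos);
    [exact: continuous_cos|exact: continuous_assoc_legendre_nat|
     exact: continuous_cos|exact: continuous_assoc_legendre_nat].
rewrite Rintegral_assoc_legendre /a /b {a b}; case: eqVneq => [<-|_]; last by rewrite mulr0.
have [ml|lm] := leqP m l; last first.
  by rewrite (ffact_small lm) mulr0 !mul0r mulr0.
rewrite -expr2 sqr_sqrtr ?divr_ge0 ?mulr_ge0//.
have /(congr1 (fun n => n%:R : R)) := ffact_fact ml; rewrite natrM => h1.
have /(congr1 (fun n => n%:R : R)) := ffact_fact (leq_addl l m); rewrite natrM addnK => h2.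
have lm0 : (l - m)`!%:R != 0 :> R by rewrite pnatr_eq0 -lt0n fact_gt0.
have l0 : l`!%:R != 0 :> R by rewrite pnatr_eq0 -lt0n fact_gt0.
have k0 : (2 * l + 1)%:R != 0 :> R by rewrite addn1 pnatr_eq0.
have a0 : (l ^_ m)%:R != 0 :> R by rewrite pnatr_eq0 -lt0n ffact_gt0.
have b0 : ((l + m) ^_ m)%:R != 0 :> R.
  by rewrite pnatr_eq0 -lt0n ffact_gt0 leq_addl.
rewrite -h2 -h1 -[(2 * l).+1]addn1 -[true%:R]/(1 : R).
move: (l - m)`! (l ^_ m) ((l + m) ^_ m) (2 * l + 1)%N lm0 a0 b0 k0 => c a b e c0 a0 b0 e0.
by field; rewrite c0 a0 b0 e0.
Qed.

End SphericalHarmonics.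

Section SphereParseval.
Context {R : realType}.
Implicit Types (x : 3.-tuple R) (p : R * R).

Lemma measurable_comp_colatitude (f : R -> R) : continuous f ->
  measurable_fun (@sphere R) (fun x => f (cos (colatitude x))).
Proof.
move=> cf; apply: (eq_measurable_fun (fun x => f (tnth x (inord 2)))).
  by move=> x /[!inE] xS; rewrite cos_colatitude.
apply: measurable_funTS; apply: (measurableT_comp (f := f)) => //.
  exact: continuous_measurable_fun.
exact: measurable_coord.
Qed.

Lemma spherical_colatitude p : cos (colatitude (spherical p)) = cos p.1.
Proof. by rewrite cos_colatitude; [case: (tnth_spherical p)|exact: spherical_sphere]. Qed.

Lemma Re_Im_sph_harmonic (l m : nat) x : (m <= l)%N ->
  complex.Re (sph_harmonic l m x) =
    norm_legendre l m (cos (colatitude x)) * trig (m, false) (longitude x) /\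
  complex.Im (sph_harmonic l m x) =
    norm_legendre l m (cos (colatitude x)) * trig (m, true) (longitude x).
Proof.
move=> ml; rewrite /sph_harmonic /norm_legendre /trig /cis/= !mul0r subr0 addr0.
by rewrite subzn// !absz_nat.
Qed.

(** |e^{i m phi}| = 1. For negative orders the factor (l-n)!/(l+n)! in [assoc_legendre] compensates
    the inverted ratio under the square root. *)
Lemma sqr_norm_sph_harmonic (l : nat) (m : int) x : (`|m| <= l)%N ->
  complex.Re (sph_harmonic l m x) ^+ 2 + complex.Im (sph_harmonic l m x) ^+ 2 =
  norm_legendre l `|m| (cos (colatitude x)) ^+ 2.
Proof.
case: m => [m|n] ml.
  have [-> ->] := Re_Im_sph_harmonic x ml.
  by rewrite !exprMn -mulrDr /trig/= cos2Dsin2 mulr1.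
have nl : (n.+1 <= l)%N by [].
rewrite /sph_harmonic.
have -> : absz (l%:Z - Negz n) = (l + n.+1)%N by rewrite NegzE opprK.
have -> : absz (l%:Z + Negz n) = (l - n.+1)%N by rewrite NegzE subzn.
rewrite /norm_legendre /cis /= !mul0r subr0 addr0 !exprMn -mulrDr cos2Dsin2 mulr1.
rewrite !sqr_sqrtr ?divr_ge0 ?mulr_ge0// exprAC sqrrN !expr1n mul1r.
have a0 : (l - n.+1)`!%:R != 0 :> R by rewrite pnatr_eq0 -lt0n fact_gt0.
have b0 : (l + n.+1)`!%:R != 0 :> R by rewrite pnatr_eq0 -lt0n fact_gt0.
move: (l - n.+1)`! (l + n.+1)`! a0 b0 => a b a0 b0.
move: (2 * l + 1)%N (_ ^+ n.+1) (_^`(_).[_]) => e s h.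
by field; rewrite a0 b0.
Qed.

Lemma measurable_sph_harmonic (l : nat) (m : int) :
  measurable_fun (@sphere R) (fun x => complex.Re (sph_harmonic l m x)) /\
  measurable_fun (@sphere R) (fun x => complex.Im (sph_harmonic l m x)).
Proof.
have mL : measurable_fun (@sphere R)
    (fun x => assoc_legendre l m (cos (colatitude x))).
  apply: measurable_comp_colatitude; case: m => n.
    exact: continuous_assoc_legendre_nat.
  by apply: continuous_funZ; exact: continuous_assoc_legendre_nat.
have [mc ms] : measurable_fun (@sphere R) (fun x => cos (m%:~R * longitude x)) /\
    measurable_fun (@sphere R) (fun x => sin (m%:~R * longitude x)).
  have mt i : measurable_fun (@sphere R) (fun x => trig i (longitude x)).
    by apply: measurable_funTS; exact: measurable_trig_longitude.
  case: m {mL} => n; first by split; [exact: (mt (n, false))|exact: (mt (n, true))].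
  split.
    under eq_fun do rewrite NegzE mulrNz mulNr cosN.
    exact: (mt (n.+1, false)).
  under eq_fun do rewrite NegzE mulrNz mulNr sinN.
  by apply: measurableT_comp => //; exact: (mt (n.+1, true)).
have mK (k : R) (f : 3.-tuple R -> R) : measurable_fun (@sphere R) f ->
    measurable_fun (@sphere R) (fun x => k * assoc_legendre l m (cos (colatitude x)) * f x).
  by move=> mf; apply: measurable_funM => //; exact: measurable_funM.
split; rewrite /sph_harmonic /cis/=.
  by under eq_fun do rewrite mul0r subr0; exact: mK.
by under eq_fun do rewrite mul0r addr0; exact: mK.
Qed.

Definition ord_key (M : nat) (i : 'I_M * bool) : nat * bool := (val i.1, i.2).

(** The sum is grouped by order and parity, with the degree inside: at fixed colatitude it is a
    trigonometric polynomial in the longitude, which is the shape needed to apply orthogonality one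
    variable at a time. *)
Definition harmonic_sum (N M : nat) (c : nat -> nat * bool -> R) x : R :=
  \sum_(i : 'I_M * bool) (\sum_(l < N) c l (ord_key i) *
    norm_legendre l i.1 (cos (colatitude x))) * trig (ord_key i) (longitude x).

Lemma measurable_harmonic_sum N M c : measurable_fun (@sphere R) (harmonic_sum N M c).
Proof.
apply: measurable_sum => i; apply: measurable_funM.
  apply: measurable_sum => l; apply: measurable_funM => //.
  by apply: measurable_comp_colatitude; exact: continuous_norm_legendre.
by apply: measurable_funTS; exact: measurable_trig_longitude.
Qed.

(** Integrate over phi first, so that distinct (order, parity) keys decouple, then over theta, so
    that distinct degrees of the same order decouple. The weight is the density constant 1/(4 pi)
    times [trig_weight] times the Legendre norm 2. *)
Lemma integral_harmonic_sum_sqr N M c :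
  (\int[@sphere_measure R]_(x in sphere) (harmonic_sum N M c x ^+ 2)%:E =
   (\sum_(i : 'I_M * bool) \sum_(l < N)
      c l (ord_key i) ^+ 2 * ((i.1 <= l)%N%:R * (trig_weight (ord_key i) / (2 * pi))))%:E)%E.
Proof.
have pi0 : (pi : R) != 0 by rewrite gt_eqF// pi_gt0.
have mH := measurable_harmonic_sum N M c.
rewrite ge0_integral_sphere; last 2 first.
- by apply/measurable_EFinP; apply: measurable_funX.
- by move=> x _; rewrite lee_fin sqr_ge0.
pose C (i : 'I_M * bool) th : R := \sum_(l < N) c l (ord_key i) * norm_legendre l i.1 (cos th).
transitivity (\int[lebesgue_measure]_(th in `[0%R, pi])
  (\sum_(i : 'I_M * bool) ((trig_weight (ord_key i) / (4 * pi))%:E *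
     (C i th ^+ 2 * sin th)%:E)))%E.
  apply: eq_integral => th /[!inE]/= thI.
  have s0 : 0 <= sin th by apply: sin_ge0_pi; move: thI; rewrite in_itv.
  (* At the poles the longitude of [spherical (th, ph)] need not be [ph], but there the density
     vanishes. *)
  have [sth|sth] := eqVneq (sin th) 0.
    rewrite integral0_eq; first by rewrite big1// => i _; rewrite sth mulr0 mule0.
    by move=> ph _; rewrite sth mul0r mul0e.
  have {}s0 : 0 < sin th by rewrite lt_def sth.
  transitivity (\int[lebesgue_measure]_(ph in `[0%R, (2 * pi)%R])
    ((sin th / (4 * pi))%:E * ((\sum_i C i th * trig (ord_key i) ph) ^+ 2 * 1)%:E))%E.
    apply: eq_integral => ph _; rewrite mulr1 /harmonic_sum.
    congr (_ * (_ ^+ 2)%:E)%E; apply: eq_bigr => i _.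
    by rewrite spherical_colatitude trig_longitude.
  have ct (i : 'I_M * bool) : continuous (fun ph : R => C i th * trig (ord_key i) ph).
    by apply: continuous_funZ; exact: continuous_trig.
  rewrite ge0_integralZl//; last 3 first.
  - apply/measurable_EFinP; apply: measurable_funTS; apply: continuous_measurable_fun.
    apply: continuous_funM; last by move=> ?; exact: cvg_cst.
    under eq_fun do rewrite expr2.
    by apply: continuous_funM; apply: continuous_fun_sum.
  - by move=> ph _; rewrite lee_fin mulr1 sqr_ge0.
  - by rewrite lee_fin divr_ge0// ?mulr_ge0 ?pi_ge0// ltW.
  rewrite (@integral_itv_sqr_sum _ _ (fun i => trig (ord_key i)) (cst 1)
     (fun i => trig_weight (ord_key i)) (C^~ th))//.
  - rewrite -EFinM sumEFin mulr_sumr; congr EFin; apply: eq_bigr => i _.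
    by move: (trig_weight _) (C i th) (sin th) (_^-1) => w u v k; ring.
  - by move=> i; exact: continuous_trig.
  - by move=> ?; exact: cvg_cst.
  - move=> i j; rewrite Rintegral_trig.
    by congr (if _ then _ else _); rewrite /ord_key xpair_eqE; case: i j => [? ?] [? ?].
have mC i (D : set R) : measurable_fun D (fun th => (C i th ^+ 2 * sin th)%:E).
  apply/measurable_EFinP; apply: measurable_funTS; apply: continuous_measurable_fun.
  apply: continuous_funM; last exact: continuous_sin.
  have cC : continuous (C i).
    apply: continuous_fun_sum => l; apply: continuous_funZ.
    by apply: (@continuous_fun_comp _ cos); [exact: continuous_cos|exact: continuous_norm_legendre].
  by under eq_fun do rewrite expr2; apply: continuous_funM.
have C0 i th : `[0, pi]%classic th -> (0 <= (C i th ^+ 2 * sin th)%:E)%E.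
  by rewrite lee_fin /= in_itv/= => thI; rewrite mulr_ge0 ?sqr_ge0// sin_ge0_pi.
have w0 (i : 'I_M * bool) : (0 <= (trig_weight (ord_key i) / (4 * pi) : R)%:E)%E.
  rewrite lee_fin divr_ge0 ?mulr_ge0 ?pi_ge0// /trig_weight.
  by case: ifP => _; [case: ifP => _|]; rewrite ?mulr_ge0 ?pi_ge0.
rewrite ge0_integral_sum//; last 2 first.
- move=> i; apply: emeasurable_funM; [exact: measurable_cst|exact: mC].
- by move=> i th thI; rewrite mule_ge0// C0.
rewrite -sumEFin; apply: eq_bigr => i _.
rewrite ge0_integralZl//; [|exact: mC|exact: C0].
rewrite (@integral_itv_sqr_sum _ _ (fun (l : 'I_N) th => norm_legendre l i.1 (cos th)) sin
   (fun l : 'I_N => (i.1 <= l)%N%:R * 2) (fun l : 'I_N => c l (ord_key i)))//.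
- rewrite -EFinM mulr_sumr; congr EFin; apply: eq_bigr => l _.
  by move: pi pi0 (trig_weight _) => u u0 v; field.
- move=> l; apply: (@continuous_fun_comp _ cos); first exact: continuous_cos.
  exact: continuous_norm_legendre.
- exact: continuous_sin.
- by move=> l k; rewrite Rintegral_norm_legendre.
Qed.

End SphereParseval.

                                                      

(** * Second moments of the stochastic convolutions *)

Section SecondMoment.
Context {R : realType} d (Omega : measurableType d) (P : probability Omega R).

(** Cauchy-Schwarz for the factorisation w a = sqrt(w) (sqrt(w) a), proved by induction on the list
    so that no square root appears. *)
Lemma sqr_weighted_sum_le (I : Type) (s : seq I) (w a : I -> R) :
  (forall i, 0 <= w i) ->
  (\sum_(i <- s) w i * a i) ^+ 2 <=
  (\sum_(i <- s) w i) * (\sum_(i <- s) w i * a i ^+ 2).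
Proof.
move=> w0; elim: s => [|i s IH]; first by rewrite !big_nil expr0n mulr0.
rewrite !big_cons.
have W0 : 0 <= \sum_(j <- s) w j by exact: sumr_ge0.
have B0 : 0 <= \sum_(j <- s) w j * a j ^+ 2.
  by apply: sumr_ge0 => j _; rewrite mulr_ge0 ?sqr_ge0.
move: (\sum_(j <- s) w j) (\sum_(j <- s) w j * a j) (\sum_(j <- s) w j * a j ^+ 2)
  (w i) (w0 i) (a i) W0 B0 IH => W A B v v0 u W0 B0 AWB.
(* Multiplied by W, the difference of the two sides is (W u - A)^2 + (W B - A^2), nonnegative by the
   induction hypothesis. *)
suff h : 2 * A * u <= W * u ^+ 2 + B.
  rewrite -subr_ge0 (_ : _ - _ = W * B - A ^+ 2 + v * (W * u ^+ 2 + B - 2 * A * u)).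
    by rewrite addr_ge0 ?mulr_ge0 ?subr_ge0.
  by ring.
have [W00|Wn0] := eqVneq W 0.
  have A0 : A = 0.
    by apply/eqP; rewrite -sqrf_eq0 eq_le sqr_ge0 andbT; move: AWB; rewrite W00 mul0r.
  by rewrite A0 W00 mulr0 !mul0r add0r.
have Wp : 0 < W by rewrite lt_def Wn0.
rewrite -subr_ge0 -(pmulr_rge0 _ Wp).
have -> : W * (W * u ^+ 2 + B - 2 * A * u) = (W * u - A) ^+ 2 + (W * B - A ^+ 2) by ring.
by rewrite addr_ge0 ?sqr_ge0// subr_ge0.
Qed.

Lemma abel_sum (f c : nat -> R) (n : nat) : c 0%N = 0 ->
  \sum_(i < n.+1) f i * (c i.+1 - c i) =
  f n * c n.+1 + \sum_(i < n) (f i.+1 - f i) * (- c i.+1).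
Proof.
move=> c0; elim: n => [|n IHn].
  rewrite big_ord_recr !big_ord0/= c0; ring.
rewrite big_ord_recr/= IHn [in RHS]big_ord_recr/=; ring.
Qed.

(** After summation by parts the coefficients are f_n and, up to sign, the increments of [f]. They
    total 2 f_n - f_0 <= 2, and the weighted Cauchy-Schwarz inequality applies. The type
    [option 'I_n] adds the index of the term f_n. *)
Lemma abel_sum_sqr_le (f c : nat -> R) (n : nat) : c 0%N = 0 ->
  0 <= f 0%N -> f n <= 1 -> (forall i, (i < n)%N -> f i <= f i.+1) ->
  (\sum_(i < n.+1) f i * (c i.+1 - c i)) ^+ 2 <=
  2 * (f n * c n.+1 ^+ 2 + \sum_(i < n) (f i.+1 - f i) * c i.+1 ^+ 2).
Proof.
move=> c0 f0 fn1 fnd; rewrite abel_sum//.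
have fn0 : f 0%N <= f n.
  have : forall k, (k <= n)%N -> f 0%N <= f k.
    by elim=> // k IHk kn; rewrite (le_trans (IHk (ltnW kn)))// fnd.
  exact.
pose w (o : option 'I_n) := if o is Some i then f i.+1 - f i else f n.
pose a (o : option 'I_n) := if o is Some i then - c i.+1 else c n.+1.
have w0 o : 0 <= w o.
  by case: o => [i|]; rewrite /w/= ?subr_ge0 ?fnd//; exact: le_trans fn0.
have := sqr_weighted_sum_le (None :: map Some (index_enum 'I_n)) a w0.
rewrite !big_cons !big_map /=.
have -> : \sum_(i < n) (f i.+1 - f i) = f n - f 0%N.
  by rewrite -(big_mkord xpredT (fun i => f i.+1 - f i)) telescope_sumr.
move=> /le_trans; apply.
under [X in _ * (_ + X)]eq_bigr do rewrite sqrrN.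
apply: ler_wpM2r; last by lra.
rewrite addr_ge0//; first by rewrite mulr_ge0 ?sqr_ge0//; exact: le_trans fn0.
by apply: sumr_ge0 => i _; rewrite mulr_ge0 ?sqr_ge0// subr_ge0 fnd.
Qed.

(** Expectation of the previous bound: the factor 2 in front and a total weight at most 2 give 4.
    Only the second moments of the individual [c i] enter. *)
Lemma expectation_abel_sqr_le (f : nat -> R) (c : nat -> Omega -> R) (n : nat) (K : R) :
  (forall w, c 0%N w = 0) -> (forall i, (i <= n.+1)%N -> measurable_fun setT (c i)) ->
  (forall i, (i <= n.+1)%N -> (\int[P]_w (c i w ^+ 2)%:E <= K%:E)%E) ->
  0 <= f 0%N -> f n <= 1 -> (forall i, (i < n)%N -> f i <= f i.+1) ->
  (\int[P]_w ((\sum_(i < n.+1) f i * (c i.+1 w - c i w)) ^+ 2)%:E <= (4 * K)%:E)%E.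
Proof.
move=> c0 mc cK f0 fn1 fnd.
have fn0 : f 0%N <= f n.
  have : forall k, (k <= n)%N -> f 0%N <= f k.
    by elim=> // k IHk kn; rewrite (le_trans (IHk (ltnW kn)))// fnd.
  exact.
have K0 : 0 <= K.
  rewrite -lee_fin; apply: le_trans (cK 0%N _) => //.
  by apply: integral_ge0 => w _; rewrite lee_fin sqr_ge0.
have mcE i : (i <= n.+1)%N -> measurable_fun setT (fun w => (c i w ^+ 2)%:E).
  by move=> ni; apply/measurable_EFinP; apply: measurable_funX; exact: mc.
have fd0 (i : 'I_n) : 0 <= f i.+1 - f i by rewrite subr_ge0 fnd.
have fnn : 0 <= f n by exact: le_trans fn0.
apply: (@le_trans _ _ (\int[P]_w (2%:E * ((f n)%:E * (c n.+1 w ^+ 2)%:E +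
    \sum_(i < n) (f i.+1 - f i)%:E * (c i.+1 w ^+ 2)%:E)))%E).
  apply: ge0_le_integral => //.
  - by move=> w _; rewrite lee_fin sqr_ge0.
  - apply/measurable_EFinP; apply: measurable_funX; apply: measurable_sum => i.
    apply: measurable_funM => //; apply: measurable_funB; apply: mc => //.
    by rewrite ltnW.
  - apply: measurable_funeM; apply: emeasurable_funD.
      by apply: measurable_funeM; exact: mcE.
    by apply: emeasurable_sum => i; apply: measurable_funeM; apply: mcE; rewrite ltnS ltnW.
  - move=> w _.
    under [X in (_ <= _ * (_ + X))%E]eq_bigr do rewrite -EFinM.
    rewrite -EFinM sumEFin -EFinD -EFinM lee_fin.
    exact: (@abel_sum_sqr_le f (c ^~ w)).
have -> : 4 * K = 2 * (2 * K) by ring.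
rewrite ge0_integralZl//; last 2 first.
- apply: emeasurable_funD; first by apply: measurable_funeM; exact: mcE.
  by apply: emeasurable_sum => i; apply: measurable_funeM; apply: mcE; rewrite ltnS ltnW.
- move=> w _; rewrite adde_ge0//; first by rewrite mule_ge0// lee_fin ?sqr_ge0.
  by apply: sume_ge0 => i _; rewrite mule_ge0// lee_fin ?sqr_ge0.
rewrite EFinM lee_pmul2l//.
rewrite ge0_integralD//; last 4 first.
- by move=> w _; rewrite mule_ge0// lee_fin ?sqr_ge0.
- by apply: measurable_funeM; exact: mcE.
- by move=> w _; apply: sume_ge0 => i _; rewrite mule_ge0// lee_fin ?sqr_ge0.
- by apply: emeasurable_sum => i; apply: measurable_funeM; apply: mcE; rewrite ltnS ltnW.
rewrite ge0_integral_sum//; last 2 first.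
- by move=> i; apply: measurable_funeM; apply: mcE; rewrite ltnS ltnW.
- by move=> i w _; rewrite mule_ge0// lee_fin ?sqr_ge0.
apply: (@le_trans _ _ ((f n * K)%:E + \sum_(i < n) ((f i.+1 - f i) * K)%:E)%E).
  apply: leeD.
    rewrite ge0_integralZl ?lee_fin//; [|exact: mcE|by move=> w _; rewrite lee_fin sqr_ge0].
    by rewrite EFinM lee_wpmul2l// ?lee_fin// cK.
  apply: lee_sum => i _; have ni : (i.+1 <= n.+1)%N by rewrite ltnS ltnW.
  rewrite ge0_integralZl ?lee_fin//; [|exact: mcE|by move=> w _; rewrite lee_fin sqr_ge0].
  by rewrite EFinM lee_wpmul2l// ?lee_fin// cK.
rewrite sumEFin -EFinD lee_fin -mulr_suml -mulrDl.
rewrite -(big_mkord xpredT (fun i => f i.+1 - f i)) telescope_sumr//.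
by apply: ler_wpM2r => //; lra.
Qed.

(** Truncate: it suffices to bound E min(Z^2, k) uniformly in k and let k grow by monotone
    convergence. Where S and Z differ by at most 1, Z^2 <= 2 S^2 + 2; on the exceptional event the
    truncated value is at most k. *)
Lemma second_moment_cvg_proba (Z : Omega -> R) (B : R) : measurable_fun setT Z ->
  (forall e : R, 0 < e -> exists S : Omega -> R, [/\ measurable_fun setT S,
    (\int[P]_w (S w ^+ 2)%:E <= B%:E)%E &
    (P [set w | e < `|S w - Z w|]%R <= e%:E)%E]) ->
  (\int[P]_w (Z w ^+ 2)%:E <= (2 * B + 3)%:E)%E.
Proof.
move=> mZ hZ.
pose g (k : nat) w := (Num.min (Z w ^+ 2) k%:R)%:E.
have mg k : measurable_fun setT (g k).
  by apply/measurable_EFinP; apply: measurable_minr => //; exact: measurable_funX.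
have g0 k w : (0 <= g k w)%E by rewrite lee_fin le_min sqr_ge0 ler0n.
have ndg w (k l : nat) : (k <= l)%N -> (g k w <= g l w)%E.
  by move=> kl; rewrite lee_fin le_min !ge_min lexx/= ler_nat kl orbT.
have gZ w : g ^~ w @ \oo --> (Z w ^+ 2)%:E.
  apply: cvg_near_cst; near=> k; rewrite /g min_l//.
  near: k; exact: nbhs_infty_ger.
have -> : (\int[P]_w (Z w ^+ 2)%:E = limn (fun k => \int[P]_w g k w))%E.
  rewrite -monotone_convergence//; last by move=> w _ k l; exact: ndg.
  by apply: eq_integral => w _; apply/esym/cvg_lim => //; exact: gZ.
apply: lime_le.
  apply: ereal_nondecreasing_is_cvgn => k l kl.
  by apply: ge0_le_integral => // w _; exact: ndg.
apply: nearW => k.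
(* The tolerance 1/(k+1) serves twice: it is at most 1, and the exceptional event contributes at
   most k/(k+1) <= 1. The additive constant 3 is 2 + 1. *)
have k0 : 0 < k.+1%:R^-1 :> R by rewrite invr_gt0.
have [S [mS SB Sk]] := hZ _ k0.
pose D := [set w | k.+1%:R^-1 < `|S w - Z w|].
have mD : measurable D.
  rewrite (_ : D = (fun w => `|S w - Z w|) @^-1` `]k.+1%:R^-1, +oo[); last first.
    by apply/seteqP; split=> w /=; rewrite in_itv/= andbT.
  rewrite -[X in measurable X]setTI.
  have : measurable_fun setT (fun w => `|S w - Z w|).
    by apply: measurableT_comp => //; exact: measurable_funB.
  by apply => //; exact: measurable_itv.
have mS2 : measurable_fun setT (fun w => (2 * S w ^+ 2)%:E).
  by apply/measurable_EFinP; apply: measurable_funM => //; exact: measurable_funX.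
have mDk : measurable_fun setT (fun w => (2 + k%:R * \1_D w : R)%:E).
  by apply/measurable_EFinP; apply: measurable_funD => //; apply: measurable_funM.
apply: (@le_trans _ _ (\int[P]_w ((2 * S w ^+ 2)%:E + (2 + k%:R * \1_D w)%:E))%E).
  apply: ge0_le_integral => //; first exact: emeasurable_funD.
  move=> w _; rewrite -EFinD lee_fin.
  have [wD|wD] := boolP (w \in D).
    rewrite indicE wD mulr1 ge_min; apply/orP; right.
    by have := sqr_ge0 (S w); lra.
  rewrite indicE (negbTE wD) mulr0 addr0 ge_min; apply/orP; left.
  have {wD} : `|S w - Z w| <= 1.
    have : ~ D w by move=> Dw; move/negP: wD; apply; rewrite inE.
    move=> /negP; rewrite -leNgt => /le_trans; apply.
    by rewrite invf_le1 ?ler1n.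
  rewrite ler_norml => /andP[h1 h2].
  have : (S w - Z w) ^+ 2 <= 1 by nra.
  by have := sqr_ge0 (Z w - 2 * S w); nra.
rewrite ge0_integralD//; last 1 first.
- by move=> w _; rewrite lee_fin mulr_ge0 ?sqr_ge0.
have -> : 2 * B + 3 = 2 * B + (2 + 1) by ring.
rewrite (EFinD (2 * B)) leeD//.
  under eq_integral do rewrite EFinM.
  rewrite ge0_integralZl ?lee_fin//; last 2 first.
  - by apply/measurable_EFinP; exact: measurable_funX.
  - by move=> w _; rewrite lee_fin sqr_ge0.
  by rewrite EFinM lee_pmul2l.
under eq_integral do rewrite EFinD.
rewrite ge0_integralD//; last 1 first.
- by apply/measurable_EFinP; apply: measurable_funM.
rewrite (EFinD 2 1) leeD//.
  rewrite integral_cst// -[leRHS]mule1; apply: lee_wpmul2l; first by rewrite lee_fin.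
  exact: probability_le1.
under eq_integral do rewrite EFinM.
rewrite ge0_integralZl ?lee_fin//; last by apply/measurable_EFinP.
rewrite integral_indic// setIT.
apply: (@le_trans _ _ (k%:R%:E * k.+1%:R^-1%:E)%E).
  by rewrite lee_wpmul2l// lee_fin.
by rewrite -EFinM lee_fin ler_pdivrMr// mul1r ler_nat.
Unshelve. all: by end_near.
Qed.

End SecondMoment.

Section StochasticConvolution.
Context {R : realType} d (Omega : measurableType d) (P : probability Omega R).

Lemma measurable_gaussian_family (T : Type) (D : set T) (Z : T -> Omega -> R) x :
  gaussian_family P D Z -> D x -> measurable_fun setT (Z x).
Proof.
move=> gZ Dx; have [+ _] := gZ 1%N (fun=> x) (fun=> 1) (fun=> Dx).
by under eq_fun do rewrite big_ord1 mul1r.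
Qed.

(** For s <= 1 the power is at most 1; for s >= 1 the exponent 2H < 2 gives at most s^2. The bound
    is therefore uniform in H. *)
Lemma powR_le_1Dsqr (s t H : R) : 0 <= s -> s <= t -> 1 / 2 <= H -> H < 1 ->
  s `^ (2 * H) <= 1 + t ^+ 2.
Proof.
move=> s0 st H2 H1; have [s1|/ltW s1] := leP s 1.
  apply: (@le_trans _ _ 1); last by rewrite lerDl sqr_ge0.
  have h : 0 <= 2 * H by lra.
  have : s `^ (2 * H) <= 1 `^ (2 * H) by apply: (ge0_ler_powR h); rewrite ?nnegrE.
  by rewrite powR1.
apply: (@le_trans _ _ (s ^+ 2)).
  by rewrite -powR_mulrn//; apply: ler_powR => //; lra.
apply: (@le_trans _ _ (t ^+ 2)); last by rewrite lerDr.
by rewrite lerXn2r ?nnegrE// (le_trans s0).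
Qed.

(** The kernel increases in s and stays in [0, 1], so every left-endpoint Riemann-Stieltjes sum has
    second moment at most 4(1+t^2) by Abel summation. The passage to the limit in probability
    doubles this and adds 3. The result depends on neither H nor [lambda]. *)
Lemma stochastic_convolution_second_moment (H lambda t : R) (b : R -> Omega -> R)
    (Z : Omega -> R) : 1 / 2 <= H -> H < 1 -> 0 <= lambda -> 0 < t ->
  is_fBm P H b ->
  is_RS_integral P (fun s => expR (- lambda * (t - s))) b 0 t Z ->
  measurable_fun setT Z /\
  (\int[P]_w (Z w ^+ 2)%:E <= (8 * (1 + t ^+ 2) + 3)%:E)%E.
Proof.
move=> H2 H1 l0 t0 [gb _ _ bE] [mZ hZ]; split => //.
have mb s : 0 <= s -> measurable_fun setT (b s).
  by move=> s0; exact: measurable_gaussian_family gb s0.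
have -> : 8 * (1 + t ^+ 2) + 3 = 2 * (4 * (1 + t ^+ 2)) + 3 by ring.
apply: second_moment_cvg_proba => // e e0.
have [delta delta0 hd] := hZ e e0.
(* With n+1 equal intervals the mesh t/(n+1) is below [delta]. *)
pose n := Num.truncn (t / delta).
pose s (i : nat) := t * (i%:R / n.+1%:R).
have s0 : s 0%N = 0 by rewrite /s mul0r mulr0.
have sn : s n.+1 = t by rewrite /s divff ?mulr1// pnatr_eq0.
have sS i : s i.+1 - s i = t / n.+1%:R.
  by rewrite /s -mulrBr -mulrBl -natr1 addrAC subrr add0r mul1r.
have dt : 0 < t / n.+1%:R by rewrite divr_gt0.
have ss i : s i <= s i.+1 by rewrite -subr_ge0 sS ltW.
have sge0 i : 0 <= s i by rewrite /s mulr_ge0 ?divr_ge0// ltW.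
have sle i : (i <= n.+1)%N -> s i <= t.
  by move=> ni; rewrite -[leRHS]mulr1 ler_wpM2l ?(ltW t0)// ler_pdivrMr// mul1r ler_nat.
pose f s := expR (- lambda * (t - s)).
exists (fun w => RS_sum f (b ^~ w) n.+1 s s); split.
- apply: measurable_sum => i; apply: measurable_funM => //.
  by apply: measurable_funB; exact: mb.
(* [b 0] vanishes only almost surely, whereas subtracting it gives c_0 = 0 for every outcome, and E
   c_i^2 is exactly the increment formula of fBm. *)
- pose c i w := b (s i) w - b 0 w.
  have E w : RS_sum f (b ^~ w) n.+1 s s = \sum_(i < n.+1) f (s i) * (c i.+1 w - c i w).
    by apply: eq_bigr => i _; rewrite /c; congr (_ * _); ring.
  under eq_integral do rewrite E.
  apply: (@expectation_abel_sqr_le _ _ _ _ (f \o s) c) => /=.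
  + by move=> w; rewrite /c s0 subrr.
  + by move=> i _; apply: measurable_funB; exact: mb.
  + move=> i ni; have := bE 0 (s i) (lexx 0) (sge0 i).
    rewrite unlock subr0 ger0_norm// => ->.
    by rewrite lee_fin powR_le_1Dsqr// sle.
  + exact: expR_ge0.
  + by rewrite /f -expR0 ler_expR mulNr oppr_le0 mulr_ge0// subr_ge0 sle.
  + by move=> i _; rewrite ler_expR !mulNr lerN2 ler_wpM2l// lerB.
- apply: hd; first by split => // i _; rewrite lexx ss.
  move=> i _; rewrite sS ltr_pdivrMr// mulrC -ltr_pdivrMr//.
  exact: truncnS_gt.
Qed.

End StochasticConvolution.

                                    

(** * Random fields on the sphere: finiteness of the measure, Tonelli, isotropy *)

Section SphereFinite.
Context {R : realType}.

Lemma sphere_measure_setT : @sphere_measure R setT = sphere_measure sphere.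
Proof.
congr (\int[_]_(p in _) _)%E; rewrite preimage_setT; congr (_ `&` _).
by apply/seteqP; split => p // _; exact: spherical_sphere.
Qed.

Lemma sphere_measure_lty : (@sphere_measure R sphere < +oo)%E.
Proof.
have mS := @measurable_sphere R.
rewrite -[X in (X < _)%E]mul1e -(integral_cst _ mS) ge0_integral_sphere//.
have L : lebesgue_measure `[0%R, (2 * pi)%R : R] = (2 * pi)%:E.
  by rewrite lebesgue_measure_itv/= lte_fin mulr_gt0 ?pi_gt0// oppr0 adde0.
rewrite [X in (X < _)%E](_ : _ = (\int[lebesgue_measure]_(th in `[0%R, pi])
    (sin th / (4 * pi) * (2 * pi))%:E)%E); last first.
  apply: eq_integral => th _; rewrite /cst; under eq_integral do rewrite mule1.
  by rewrite integral_cst// [X in (_ * X)%E]L.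
rewrite EFin_Rintegral_itv ?ltry//.
apply: continuous_funM; last by move=> ?; exact: cvg_cst.
apply: continuous_funM; last by move=> ?; exact: cvg_cst.
exact: continuous_sin.
Qed.

Lemma sphere_measure_fin : fin_num_fun (@sphere_measure R).
Proof.
apply: lty_fin_num_fun; have := sphere_measure_lty.
by rewrite -sphere_measure_setT.
Qed.

(** Finiteness makes Tonelli's theorem available for products with the sphere measure. *)
HB.instance Definition _ := Measure_isFinite.Build _ _ _ (@sphere_measure R) sphere_measure_fin.

End SphereFinite.

Section Fields.
Context {R : realType} d (Omega : measurableType d) (P : probability Omega R).
Let mS := @measurable_sphere R.

Lemma measurable_field_sphere : measurable ([set: Omega] `*` @sphere R).
Proof. by apply: measurableX. Qed.

Lemma measurable_field_section d' (T : measurableType d') (f : Omega -> 3.-tuple R -> T) w :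
  measurable_fun ([set: Omega] `*` sphere) (fun p => f p.1 p.2) ->
  measurable_fun sphere (f w).
Proof.
move=> mf; rewrite -[f w]/((fun p => f p.1 p.2) \o pair w).
apply: (measurable_comp measurable_field_sphere _ mf).
  by move=> _ [x xS <-].
exact: measurable_funTS.
Qed.

(** A field is measurable only over the sphere; its extension by 0 is measurable everywhere, as
    Tonelli requires. *)
Lemma measurable_field_restrict (f : Omega -> 3.-tuple R -> \bar R) :
  measurable_fun ([set: Omega] `*` sphere) (fun p => f p.1 p.2) ->
  measurable_fun setT (fun p : Omega * 3.-tuple R => ((f p.1) \_ sphere) p.2).
Proof.
move=> /(measurable_restrictT _ measurable_field_sphere).
congr measurable_fun; apply/funext => -[w x]; rewrite !patchE/=.
congr (if _ then _ else _); apply/idP/idP => /[!inE]; last by [].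
by case.
Qed.

Section Tonelli.
Variable f : Omega -> 3.-tuple R -> \bar R.
Hypothesis mf : measurable_fun ([set: Omega] `*` sphere) (fun p => f p.1 p.2).
Hypothesis f0 : forall w x, sphere x -> (0 <= f w x)%E.

Let f0r p : (0 <= ((f p.1) \_ sphere) p.2)%E.
Proof. by rewrite patchE; case: ifPn => // /[!inE]; exact: f0. Qed.

Lemma measurable_integral_sphere :
  measurable_fun setT (fun w => \int[@sphere_measure R]_(x in sphere) f w x)%E.
Proof.
under eq_fun do rewrite integral_mkcond.
exact: (measurable_fun_fubini_tonelli_F _ (measurable_field_restrict mf) f0r).
Qed.

Lemma measurable_integral_field :
  measurable_fun sphere (fun x => \int[P]_w f w x)%E.
Proof.
apply: (eq_measurable_fun (fun x => \int[P]_w ((f w) \_ sphere) x)%E).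
  by move=> x xS; apply: eq_integral => w _; rewrite patchE xS.
apply: measurable_funTS.
exact: (measurable_fun_fubini_tonelli_G _ (measurable_field_restrict mf) f0r).
Qed.

Lemma integral_sphere_exchange :
  (\int[P]_w \int[@sphere_measure R]_(x in sphere) f w x =
   \int[@sphere_measure R]_(x in sphere) \int[P]_w f w x)%E.
Proof.
under eq_integral do rewrite integral_mkcond.
have := fubini_tonelli (m1 := P) (m2 := @sphere_measure R) _ (measurable_field_restrict mf) f0r.
rewrite /fubini_F /fubini_G => ->.
rewrite [RHS]integral_mkcond; apply: eq_integral => x _; rewrite patchE.
case: ifPn => xS; first by apply: eq_integral => w _; rewrite patchE xS.
by apply: integral0_eq => w _; rewrite patchE (negbTE xS).
Qed.

End Tonelli.

End Fields.

Section Isotropy.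
Context {R : realType}.

Lemma det2E (f : nat -> nat -> R) :
  \det (\matrix_(i < 2, j < 2) f i j) = f 0 0 * f 1 1 - f 0 1 * f 1 0.
Proof.
rewrite (expand_det_row _ ord0) !big_ord_recl big_ord0 /cofactor !det_mx11 !mxE /=.
by rewrite /bump/= expr0 expr1; ring.
Qed.

Lemma det3E (f : nat -> nat -> R) :
  \det (\matrix_(i < 3, j < 3) f i j) =
  f 0 0 * (f 1 1 * f 2 2 - f 1 2 * f 2 1) -
  f 0 1 * (f 1 0 * f 2 2 - f 1 2 * f 2 0) +
  f 0 2 * (f 1 0 * f 2 1 - f 1 1 * f 2 0).
Proof.
rewrite (expand_det_row _ ord0) !big_ord_recl big_ord0 /cofactor.
have E k : row' ord0 (col' k (\matrix_(i < 3, j < 3) f i j)) =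
   \matrix_(i < 2, j < 2) f (bump 0 i) (bump k j).
  by apply/matrixP => i j; rewrite !mxE.
by rewrite !E !(det2E (fun i j => f (bump _ i) (bump _ j))) !mxE /=; ring.
Qed.

                                                                            
                                                                     
(** Rotation by th about the second axis followed by rotation by ph about the third; it carries the
    north pole [spherical (0, 0)] to [spherical (th, ph)]. *)
Definition rotation_to (th ph : R) : 'M[R]_3 :=
  \matrix_(i < 3, j < 3) nth 0 (nth [::]
    [:: [:: cos th * cos ph; - sin ph; sin th * cos ph];
        [:: cos th * sin ph; cos ph; sin th * sin ph];
        [:: - sin th; 0; cos th]] i) j.

Lemma rotation_to_is_rotation th ph : is_rotation (rotation_to th ph).
Proof.
have h1 : cos th ^+ 2 = 1 - sin th ^+ 2 by rewrite -(cos2Dsin2 th) addrK.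
have h2 : cos ph ^+ 2 = 1 - sin ph ^+ 2 by rewrite -(cos2Dsin2 ph) addrK.
split; last first.
  by rewrite (det3E (fun i j => nth 0 (nth [::] _ i) j))/=; ring: h1 h2.
apply/matrixP => i j; rewrite mxE !big_ord_recr big_ord0 /= !mxE /=.
move: (cos th) (sin th) (cos ph) (sin ph) h1 h2 => c s a b h1 h2.
by case: i j => [[|[|[|//]]] ?] [[|[|[|//]]] ?]; rewrite /= ?mulr1n ?mulr0n; ring: h1 h2.
Qed.

Lemma rotate_rotation_to th ph :
  rotate (rotation_to th ph) (spherical (0, 0)) = spherical (th, ph).
Proof.
apply: eq_from_tnth => i; rewrite tnth_mktuple !big_ord_recr big_ord0 /= !mxE/=.
rewrite !(tnth_nth 0) /= sin0 cos0 !mul0r !mulr0 !add0r mulr1.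
by case: i => [[|[|[|//]]] ?].
Qed.

End Isotropy.

Section FieldSecondMoment.
Context {R : realType} d (Omega : measurableType d) (P : probability Omega R).

(** Rotation invariance makes E T(x)^2 equal to its finite value at the north pole. After exchanging
    the integrals, the total is that value times the finite measure of the sphere. *)
Lemma isotropic_second_moment_lty (T : Omega -> 3.-tuple R -> R) :
  random_field T -> weakly_isotropic2 P T ->
  (\int[P]_w \int[@sphere_measure R]_(x in sphere) (T w x ^+ 2)%:E < +oo)%E.
Proof.
move=> mT [Tfin _ Trot].
have mT2 : measurable_fun ([set: Omega] `*` @sphere R) (fun p => (T p.1 p.2 ^+ 2)%:E).
  by apply/measurable_EFinP; exact: measurable_funX.
rewrite (integral_sphere_exchange _ mT2); last by move=> w x _; rewrite lee_fin sqr_ge0.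
pose N : 3.-tuple R := spherical (0, 0).
have NS : sphere N by exact: spherical_sphere.
pose K := (\int[P]_w (T w N ^+ 2)%:E)%E.
have Klty : (K < +oo)%E by have := Tfin N NS; rewrite unlock.
have K0 : (0 <= K)%E by apply: integral_ge0 => w _; rewrite lee_fin sqr_ge0.
have TK p : (\int[P]_w (T w (spherical p) ^+ 2)%:E = K)%E.
  have := Trot _ N N (rotation_to_is_rotation p.1 p.2) NS NS.
  rewrite unlock rotate_rotation_to -surjective_pairing => h.
  transitivity (\int[P]_w (T w (spherical p) * T w (spherical p))%:E)%E.
    by apply: eq_integral => w _; rewrite expr2.
  by rewrite h; apply: eq_integral => w _; rewrite expr2.
rewrite [ltLHS](_ : _ = \int[@sphere_measure R]_(x in sphere) K)%E.
  rewrite integral_cst; last exact: measurable_sphere.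
  rewrite lte_mul_pinfty// ?ge0_fin_numE//. 
  exact: sphere_measure_lty.
(* The comparison with the constant is made in coordinates, since [TK] is stated at the points
   [spherical p]. *)
rewrite ge0_integral_sphere; last 2 first.
- by apply: measurable_integral_field => // w x _; rewrite lee_fin sqr_ge0.
- by move=> x _; apply: integral_ge0 => w _; rewrite lee_fin sqr_ge0.
rewrite (@ge0_integral_sphere _ (fun=> K)); last 2 first.
- exact: measurable_cst.
- by [].
by apply: eq_integral => th _; apply: eq_integral => ph _; rewrite TK.
Qed.

End FieldSecondMoment.

(** * Fourier coefficients, exponential decay and the contribution of the initial field *)

Section CauchySchwarz.
Context {R : realType} d (T : measurableType d) (mu : {measure set T -> \bar R}).
Variables (D : set T) (f g : T -> R).
Hypotheses (mD : measurable D) (mf : measurable_fun D f) (mg : measurable_fun D g).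
Hypothesis fD : (\int[mu]_(x in D) (f x ^+ 2)%:E < +oo)%E.
Hypothesis gD : (\int[mu]_(x in D) (g x ^+ 2)%:E < +oo)%E.

Let sqr_integrable (h : T -> R) : measurable_fun D h ->
  (\int[mu]_(x in D) (h x ^+ 2)%:E < +oo)%E ->
  mu.-integrable D (EFin \o (fun x => h x ^+ 2)).
Proof.
move=> mh hD; apply/integrableP; split.
  by apply/measurable_EFinP; exact: measurable_funX.
by under eq_integral do rewrite /= ger0_norm ?sqr_ge0//.
Qed.

Lemma integrable_mul_sqr : mu.-integrable D (EFin \o (fun x => f x * g x)).
Proof.
have fi := sqr_integrable mf fD; have gi := sqr_integrable mg gD.
apply: (le_integrable mD _ _ (integrableD mD fi gi)).
  by apply/measurable_EFinP; exact: measurable_funM.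
move=> x _ /=; rewrite lee_fin [leRHS]ger0_norm ?addr_ge0 ?sqr_ge0//.
by rewrite ler_norml; apply/andP; split;
  have := sqr_ge0 (f x + g x); have := sqr_ge0 (f x - g x);
  have := sqr_ge0 (f x); have := sqr_ge0 (g x); nra.
Qed.

(** The integral of (f - s g)^2 is a quadratic polynomial in s that is nonnegative for every s; s =
    c/b gives the inequality. *)
Lemma Rintegral_mul_sqr_le :
  (((\int[mu]_(x in D) (f x * g x))%R ^+ 2)%:E <=
   \int[mu]_(x in D) (f x ^+ 2)%:E * \int[mu]_(x in D) (g x ^+ 2)%:E)%E.
Proof.
have fi := sqr_integrable mf fD; have gi := sqr_integrable mg gD.
have fgi := integrable_mul_sqr.
pose a := \int[mu]_(x in D) f x ^+ 2; pose b := \int[mu]_(x in D) g x ^+ 2.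
pose c := \int[mu]_(x in D) (f x * g x).
have aE : (\int[mu]_(x in D) (f x ^+ 2)%:E)%E = a%:E.
  by rewrite /a /Rintegral fineK//; exact: (integrable_fin_num mD fi).
have bE : (\int[mu]_(x in D) (g x ^+ 2)%:E)%E = b%:E.
  by rewrite /b /Rintegral fineK//; exact: (integrable_fin_num mD gi).
rewrite aE bE -EFinM lee_fin -/c.
have key (s : R) : 0 <= a - 2 * s * c + s ^+ 2 * b.
  have -> : a - 2 * s * c + s ^+ 2 * b = \int[mu]_(x in D) (f x - s * g x) ^+ 2.
    transitivity (\int[mu]_(x in D) (f x ^+ 2 - (2 * s) * (f x * g x) + s ^+ 2 * g x ^+ 2)).
      have i1 : mu.-integrable D (EFin \o (fun x => 2 * s * (f x * g x))).
        exact: (integrableZl mD _ fgi).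
      have i2 : mu.-integrable D (EFin \o (fun x => s ^+ 2 * g x ^+ 2)).
        exact: (integrableZl mD _ gi).
      have i3 : mu.-integrable D (EFin \o (fun x => f x ^+ 2 - 2 * s * (f x * g x))).
        exact: (integrableB mD fi i1).
      by rewrite RintegralD// RintegralB// !RintegralZl.
    by apply: eq_Rintegral => x _; ring.
  by apply: Rintegral_ge0 => x _; exact: sqr_ge0.
have a0 : 0 <= a by have := key 0; rewrite mulr0 mul0r subr0 expr0n mul0r addr0.
have b0 : 0 <= b by apply: Rintegral_ge0 => x _; exact: sqr_ge0.
have [b00|bn0] := eqVneq b 0.
  suff -> : c = 0 by rewrite expr0n b00 mulr0.
  apply/eqP; apply/negPn/negP => cn0.
  (* If b = 0 the polynomial is affine in s; at this s it would be -1, so c must be 0. *)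
  have := key ((a + 1) / (2 * c)); rewrite b00 mulr0 addr0.
  rewrite (_ : 2 * _ * c = a + 1); last by field.
  by rewrite opprD addrA subrr add0r oppr_ge0 leNgt ltr01.
have bp : 0 < b by rewrite lt_def bn0.
have := key (c / b); rewrite (_ : _ + _ = (a * b - c ^+ 2) / b); last by field.
by rewrite pmulr_lge0 ?invr_gt0// subr_ge0.
Qed.

End CauchySchwarz.

                                                 

Section FourierCoefficients.
Context {R : realType}.
Local Notation mu := (@sphere_measure R).
Let mS := @measurable_sphere R.

Lemma sph_harmonic_small (l : nat) (m : int) (x : 3.-tuple R) :
  (l < `|m|)%N -> sph_harmonic l m x = 0.
Proof.
move=> lm; have z0 n z : (l < n)%N -> assoc_legendre_nat l n z = 0 :> R.
  move=> ln; rewrite /assoc_legendre_nat derivn_poly0 ?horner0 ?mulr0//.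
  exact: leq_trans (size_legendre l) ln.
rewrite /sph_harmonic (_ : assoc_legendre l m _ = 0) ?mulr0 ?mul0r//.
by case: m lm => n ln /=; rewrite z0// mulr0.
Qed.

(** For |m| <= l the value is exactly 1, as |Y|^2 does not depend on the longitude; for |m| > l the
    function is zero. The inequality covers every index. *)
Lemma integral_sqr_norm_sph_harmonic_le1 (l : nat) (m : int) :
  (\int[mu]_(x in sphere) (complex.Re (sph_harmonic l m x) ^+ 2 +
     complex.Im (sph_harmonic l m x) ^+ 2)%:E <= 1)%E.
Proof.
have [ml|lm] := leqP `|m| l; last first.
  rewrite integral0_eq// => x _.
  by rewrite sph_harmonic_small//= expr0n addr0.
under eq_integral do rewrite sqr_norm_sph_harmonic//.
have cl : continuous (norm_legendre l `|m| : R -> R) by exact: continuous_norm_legendre.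
rewrite ge0_integral_sphere; last 2 first.
- by apply/measurable_EFinP; apply: measurable_funX; exact: measurable_comp_colatitude.
- by move=> x _; rewrite lee_fin sqr_ge0.
have pi2 : 0 < 2 * pi :> R by rewrite mulr_gt0 ?pi_gt0.
have L : lebesgue_measure `[0%R, (2 * pi)%R : R] = (2 * pi)%:E.
  by rewrite lebesgue_measure_itv/= lte_fin pi2 oppr0 adde0.
rewrite [leLHS](_ : _ = (\int[lebesgue_measure]_(th in `[0%R, pi])
   (2^-1 * (norm_legendre l `|m| (cos th) * norm_legendre l `|m| (cos th) * sin th))%:E)%E).
  have cn : continuous (fun th : R =>
      norm_legendre l `|m| (cos th) * norm_legendre l `|m| (cos th) * sin th).
    apply: continuous_funM; last exact: continuous_sin.
    by apply: continuous_funM; apply: (@continuous_fun_comp _ cos) => //; exact: continuous_cos.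
  rewrite EFin_Rintegral_itv; last exact: continuous_funZ.
  rewrite RintegralZl//; last exact: continuous_itv_integrable.
  by rewrite Rintegral_norm_legendre eqxx ml mul1r mulVf.
apply: eq_integral => th _.
transitivity (\int[lebesgue_measure]_(ph in `[0%R, (2 * pi)%R])
   (sin th / (4 * pi) * norm_legendre l `|m| (cos th) ^+ 2)%:E)%E.
  by apply: eq_integral => ph _; rewrite spherical_colatitude.
rewrite integral_cst// [X in (_ * X)%E]L -EFinM; congr EFin.
have : pi != 0 :> R by rewrite gt_eqF// pi_gt0.
by move: pi (norm_legendre _ _ _) (sin th) => u v s u0; field.
Qed.

Lemma fourier_coefE (f : 3.-tuple R -> R) (l : nat) (m : int) :
  complex.Re (fourier_coef (fun y => (f y)%:C%C) l m) =
    \int[mu]_(x in sphere) (f x * complex.Re (sph_harmonic l m x)) /\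
  complex.Im (fourier_coef (fun y => (f y)%:C%C) l m) =
    \int[mu]_(x in sphere) (f x * - complex.Im (sph_harmonic l m x)).
Proof.
have E (a : R) (z : R[i]) : complex.Re (a%:C * z^*)%C = a * complex.Re z /\
    complex.Im (a%:C * z^*)%C = a * - complex.Im z.
  by case: z => b c /=; rewrite !mul0r subr0 addr0.
rewrite /fourier_coef /sphere_cintegral.
split; apply: eq_Rintegral => x _; [exact: (E _ _).1|exact: (E _ _).2].
Qed.

(** Cauchy-Schwarz is applied to the real and imaginary parts of Y separately; their squared norms
    add up to at most 1. If f is not square integrable the right-hand side is infinite. *)
Lemma sqr_fourier_coef_le (f : 3.-tuple R -> R) (l : nat) (m : int) :
  measurable_fun sphere f ->
  ((complex.Re (fourier_coef (fun y => (f y)%:C%C) l m) ^+ 2 +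
    complex.Im (fourier_coef (fun y => (f y)%:C%C) l m) ^+ 2)%:E <=
   \int[mu]_(x in sphere) (f x ^+ 2)%:E)%E.
Proof.
move=> mf; have [-> ->] := fourier_coefE f l m.
have [mRe mIm] := @measurable_sph_harmonic R l m.
have mRe2 : measurable_fun sphere (fun x => (complex.Re (sph_harmonic l m x : R[i]) ^+ 2)%:E).
  by apply/measurable_EFinP; exact: measurable_funX.
have mIm2 : measurable_fun sphere (fun x => (complex.Im (sph_harmonic l m x : R[i]) ^+ 2)%:E).
  by apply/measurable_EFinP; exact: measurable_funX.
have V0 : (0 <= \int[mu]_(x in sphere) (f x ^+ 2)%:E)%E.
  by apply: integral_ge0 => x _; rewrite lee_fin sqr_ge0.
have [fV|] := ltP (\int[mu]_(x in sphere) (f x ^+ 2)%:E)%E +oo%E; last first.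
  by rewrite leye_eq => /eqP ->; rewrite leey.
have := integral_sqr_norm_sph_harmonic_le1 l m.
under eq_integral do rewrite EFinD.
rewrite ge0_integralD//; last 2 first.
- by move=> x _; rewrite lee_fin sqr_ge0.
- by move=> x _; rewrite lee_fin sqr_ge0.
set p := (\int[mu]_(x in sphere) (complex.Re _ ^+ 2)%:E)%E.
set q := (\int[mu]_(x in sphere) (complex.Im _ ^+ 2)%:E)%E => pq.
have p0 : (0 <= p)%E by apply: integral_ge0 => x _; rewrite lee_fin sqr_ge0.
have q0 : (0 <= q)%E by apply: integral_ge0 => x _; rewrite lee_fin sqr_ge0.
have pfin : (p < +oo)%E by rewrite (le_lt_trans _ (ltry 1))// (le_trans _ pq)// leeDl.
have qfin : (q < +oo)%E by rewrite (le_lt_trans _ (ltry 1))// (le_trans _ pq)// leeDr.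
have hp := Rintegral_mul_sqr_le mS mf mRe fV pfin.
have mIm' : measurable_fun sphere (fun x => - complex.Im (sph_harmonic l m x : R[i])).
  exact: measurableT_comp.
have qE : (\int[mu]_(x in sphere) ((- complex.Im (sph_harmonic l m x)) ^+ 2)%:E = q)%E.
  by apply: eq_integral => x _; rewrite sqrrN.
have qfin' := qfin; rewrite -qE in qfin'.
have hq := Rintegral_mul_sqr_le mS mf mIm' fV qfin'.
rewrite qE in hq; rewrite EFinD; apply: (le_trans (leeD hp hq)).
rewrite -ge0_muleDr// -[leRHS]mule1; exact: lee_wpmul2l.
Qed.

End FourierCoefficients.

Section FourierMeasurable.
Context {R : realType} d (Omega : measurableType d).

Lemma measurable_Rintegral_sphere (f : Omega -> 3.-tuple R -> R) :
  measurable_fun ([set: Omega] `*` sphere) (fun p => f p.1 p.2) ->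
  measurable_fun setT (fun w => \int[@sphere_measure R]_(x in sphere) f w x).
Proof.
move=> mf; have mfE : measurable_fun ([set: Omega] `*` sphere) (fun p => (f p.1 p.2)%:E).
  exact/measurable_EFinP.
apply: (measurableT_comp (f := fine)) => //.
under eq_fun do rewrite integralE.
have mp : measurable_fun ([set: Omega] `*` sphere) (fun p => ((EFin \o f p.1)^\+ p.2)%E).
  by rewrite unlock; apply: measurable_maxe.
have mn : measurable_fun ([set: Omega] `*` sphere) (fun p => ((EFin \o f p.1)^\- p.2)%E).
  by rewrite unlock; apply: measurable_maxe => //; exact: measurableT_comp mfE.
apply: emeasurable_funB.
  by apply: (measurable_integral_sphere (f := fun w => (EFin \o f w)^\+%E) mp).
by apply: (measurable_integral_sphere (f := fun w => (EFin \o f w)^\-%E) mn).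
Qed.

Lemma measurable_field_mul (f : Omega -> R) (g : 3.-tuple R -> R) :
  measurable_fun setT f -> measurable_fun sphere g ->
  measurable_fun ([set: Omega] `*` sphere) (fun p => f p.1 * g p.2).
Proof.
move=> mf mg; apply: measurable_funM.
  by apply: measurable_funTS; apply: measurableT_comp => //; exact: measurable_fst.
rewrite -[X in measurable_fun _ X]/(g \o snd).
apply: (measurable_comp (@measurable_sphere R) _ mg).
  by move=> _ [p [_ pS] <-].
by apply: measurable_funTS; exact: measurable_snd.
Qed.

Lemma measurable_fourier_coef (T : Omega -> 3.-tuple R -> R) (l : nat) (m : int) :
  random_field T ->
  measurable_fun setT (fun w => complex.Re (fourier_coef (fun y => (T w y)%:C%C) l m)) /\
  measurable_fun setT (fun w => complex.Im (fourier_coef (fun y => (T w y)%:C%C) l m)).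
Proof.
move=> mT; have [mRe mIm] := @measurable_sph_harmonic R l m.
have mcst : measurable_fun setT (cst 1 : Omega -> R) by [].
have mRe' := measurable_field_mul mcst mRe.
have mIm' := measurable_field_mul mcst mIm.
split.
  under eq_fun do rewrite (fourier_coefE _ _ _).1.
  apply: (@measurable_Rintegral_sphere (fun w x => T w x * complex.Re (sph_harmonic l m x))).
  apply: measurable_funM => //.
  by move: mRe'; under eq_fun do rewrite mul1r.
under eq_fun do rewrite (fourier_coefE _ _ _).2.
apply: (@measurable_Rintegral_sphere (fun w x => T w x * - complex.Im (sph_harmonic l m x))).
apply: measurable_funM => //; apply: measurableT_comp => //.
by move: mIm'; under eq_fun do rewrite mul1r.
Qed.

End FourierMeasurable.

Section Decay.
Context {R : realType}.

(** For l >= 1, lambda_l >= 1 makes the alpha factor at least 1, and 1 + lambda_l >= l^2 makes the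
    gamma factor at least l^gamma. *)
Lemma psi_ge_powR (alpha gamma : R) (l : nat) : 0 <= alpha -> 0 < gamma ->
  (0 < l)%N -> l%:R `^ gamma <= psi alpha gamma (LB_eigenvalue l).
Proof.
move=> a0 g0 l0; rewrite /psi /LB_eigenvalue; set la := (l * l.+1)%:R.
have la1 : 1 <= la by rewrite /la ler1n muln_gt0 l0.
have h1 : 1 <= la `^ (alpha / 2).
  have : la `^ 0 <= la `^ (alpha / 2) by apply: ler_powR => //; rewrite divr_ge0.
  by rewrite powRr0.
rewrite -[leLHS]mul1r; apply: ler_pM => //; rewrite ?powR_ge0//.
have -> : l%:R `^ gamma = (l%:R ^+ 2) `^ (gamma / 2) :> R.
  by rewrite -powR_mulrn// -powRrM mulrCA divff ?mulr1.
have g2 : 0 <= gamma / 2 by rewrite divr_ge0// ltW.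
apply: (ge0_ler_powR g2); rewrite ?nnegrE ?exprn_ge0 ?addr_ge0// ?(le_trans _ la1)//.
rewrite -natrX -[1]/(1%:R) -natrD ler_nat; lia.
Qed.

(** With x = l^gamma t, e^(-x) <= (n+1)!/x^(n+1), where n is chosen with (n+1) gamma >= r+3. In this
    exponent r yields the rate and 3 leaves room to sum (2l+1)/l^3. *)
Lemma kernel_decay (alpha gamma t t0 r : R) :
  0 <= alpha -> 0 < gamma -> 0 < t -> 0 <= t0 -> 0 <= r ->
  exists2 C : R, 0 <= C & forall l, (0 < l)%N ->
    expR (- psi alpha gamma (LB_eigenvalue l) * (t + t0)) <= C * l%:R `^ (- (r + 3)).
Proof.
move=> a0 g0 t_gt0 t00 r0; pose n := Num.truncn ((r + 3) / gamma).
exists (n.+1`!%:R / t ^+ n.+1) => [|l l0].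
  by rewrite divr_ge0// exprn_ge0// ltW.
have l1 : 1 <= l%:R :> R by rewrite ler1n.
have lg0 : 0 < l%:R `^ gamma by rewrite powR_gt0// (lt_le_trans ltr01).
pose x := l%:R `^ gamma * t.
have x0 : 0 < x by rewrite mulr_gt0.
apply: (@le_trans _ _ (expR (- x))).
  rewrite ler_expR mulNr lerN2 /x; apply: ler_pM => //;
    rewrite ?(ltW lg0) ?(ltW t_gt0) ?psi_ge_powR//.
  by rewrite lerDl.
rewrite expRN powRN -[leRHS]mulrA.
have p0 : 0 < l%:R `^ (r + 3) by rewrite powR_gt0// (lt_le_trans ltr01).
have f0 : 0 < n.+1`!%:R :> R by rewrite ltr0n fact_gt0.
have tn0 : 0 < t ^+ n.+1 by rewrite exprn_gt0.
rewrite mulrA -[_ / t ^+ n.+1]invf_div -invfM lef_pV2 ?posrE ?mulr_gt0 ?expR_gt0 ?invr_gt0//.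
apply: (@le_trans _ _ (1 + x ^+ n.+1 / n.+1`!%:R)); last exact/expR_ge1Dxn/ltW.
apply: (@le_trans _ _ (x ^+ n.+1 / n.+1`!%:R)); last by rewrite lerDr.
rewrite mulrAC ler_pM2r ?invr_gt0// /x exprMn mulrC ler_pM2r//.
rewrite -powR_mulrn ?(ltW lg0)// -powRrM; apply: ler_powR => //.
rewrite -ler_pdivrMl// mulrC ltW//; exact: truncnS_gt.
Qed.

(** For l > L, l^(-r) <= L^(-r), and (2l+1)/l^3 <= 6(1/l - 1/(l+1)) telescopes to at most 6. *)
Lemma decay_sum (alpha gamma t t0 r : R) :
  0 <= alpha -> 0 < gamma -> 0 < t -> 0 <= t0 -> 0 <= r ->
  exists2 C : R, 0 <= C & forall L N : nat, (0 < L)%N ->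
    \sum_(L.+1 <= l < N.+1) (2 * l).+1%:R *
      expR (- psi alpha gamma (LB_eigenvalue l) * (t + t0)) <= C * L%:R `^ (- r).
Proof.
move=> a0 g0 t_gt0 t00 r0; have [C C0 hC] := kernel_decay a0 g0 t_gt0 t00 r0.
exists (6 * C) => [|L N L0]; first by rewrite mulr_ge0.
have Lr0 : 0 <= L%:R `^ (- r) by exact: powR_ge0.
have [LN|NL] := leqP L N; last first.
  by rewrite big_geq ?ltnS 1?ltnW// !mulr_ge0.
apply: (@le_trans _ _ (\sum_(L.+1 <= l < N.+1)
    6 * C * L%:R `^ (- r) * ((- (l.+1%:R^-1)) - (- (l%:R^-1))))).
  rewrite big_nat [leRHS]big_nat; apply: ler_sum => l /andP[Ll _].
  have l0 : (0 < l)%N by exact: leq_trans Ll.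
  have lp : 0 < l%:R :> R by rewrite ltr0n.
  have Llr : l%:R `^ (- r) <= L%:R `^ (- r) :> R.
    rewrite !powRN lef_pV2 ?posrE ?powR_gt0 ?ltr0n//.
    by apply: (ge0_ler_powR r0); rewrite ?nnegrE// ler_nat ltnW.
  apply: (@le_trans _ _ ((2 * l).+1%:R * (C * (L%:R `^ (- r) * (l%:R ^+ 3)^-1)))).
    apply: ler_wpM2l => //; apply: le_trans (hC l l0) _; apply: ler_wpM2l => //.
    rewrite opprD powRD; last by rewrite (gt_eqF lp) implybT.
    apply: ler_pM => //; rewrite ?powR_ge0//.
    by rewrite powRN powR_mulrn.
  have l1 : 1 <= l%:R :> R by rewrite ler1n.
  have -> : (2 * l).+1%:R = 2 * l%:R + 1 :> R by rewrite -natr1 natrM.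
  have -> : l.+1%:R = l%:R + 1 :> R by rewrite natr1.
  move: l%:R (L%:R `^ (- r)) l1 lp Lr0 => x y x1 x0 y0.
  rewrite (_ : _ * (C * _) = C * y * ((2 * x + 1) / x ^+ 3)); last by ring.
  rewrite (_ : 6 * C * y * _ = C * y * (6 * (x^-1 - (x + 1)^-1))); last by ring.
  apply: ler_wpM2l; first by rewrite mulr_ge0.
  have x10 : 0 < x + 1 by rewrite addr_gt0.
  rewrite ler_pdivrMr ?exprn_gt0//.
  rewrite (_ : _ * x ^+ 3 = 6 * x ^+ 2 / (x + 1)); last first.
    by field; rewrite (gt_eqF x0) (gt_eqF x10).
  by rewrite ler_pdivlMr//; nra.
rewrite -mulr_sumr telescope_sumr ?ltnS//.
rewrite -[leRHS]mulr1; apply: ler_wpM2l; first by rewrite !mulr_ge0.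
rewrite opprK addrC lerBlDr (@le_trans _ _ 1)//; last by rewrite lerDl.
by rewrite invf_le1// ler1n.
Qed.

End Decay.

Section InitialPart.
Context {R : realType} d (Omega : measurableType d) (P : probability Omega R).
Variable T : Omega -> 3.-tuple R -> R.
Hypothesis mT : random_field T.
Implicit Types (s : seq (nat * int)) (e : nat * int -> R).

Lemma Re_sum (I : Type) (r : seq I) (F : I -> R[i]) :
  complex.Re (\sum_(i <- r) F i) = \sum_(i <- r) complex.Re (F i).
Proof. by apply: (big_morph _ (fun x y => _)) => // -[? ?] [? ?]. Qed.

Lemma Im_sum (I : Type) (r : seq I) (F : I -> R[i]) :
  complex.Im (\sum_(i <- r) F i) = \sum_(i <- r) complex.Im (F i).
Proof. by apply: (big_morph _ (fun x y => _)) => // -[? ?] [? ?]. Qed.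

Definition fourier_sum s e (w : Omega) (x : 3.-tuple R) : R[i] :=
  \sum_(p <- s) (e p)%:C%C * fourier_coef (fun y => (T w y)%:C%C) p.1 p.2 *
    sph_harmonic p.1 p.2 x.

Let F (p : nat * int) w := fourier_coef (fun y => (T w y)%:C%C) p.1 p.2.
Let Y (p : nat * int) (x : 3.-tuple R) : R[i] := sph_harmonic p.1 p.2 x.

Lemma Re_Im_fourier_sum s e w x :
  complex.Re (fourier_sum s e w x) = \sum_(p <- s) e p *
    (complex.Re (F p w) * complex.Re (Y p x) - complex.Im (F p w) * complex.Im (Y p x)) /\
  complex.Im (fourier_sum s e w x) = \sum_(p <- s) e p *
    (complex.Re (F p w) * complex.Im (Y p x) + complex.Im (F p w) * complex.Re (Y p x)).
Proof.
rewrite /fourier_sum Re_sum Im_sum; split; apply: eq_bigr => p _;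
by rewrite -/(F p w) -/(Y p x); case: (F p w) (Y p x) => [a b] [a' b'] /=; ring.
Qed.

Lemma random_field_fourier_sum s e :
  random_field (fun w x => complex.Re (fourier_sum s e w x)) /\
  random_field (fun w x => complex.Im (fourier_sum s e w x)).
Proof.
have mF p := @measurable_fourier_coef R d Omega T p.1 p.2 mT.
have mY p := @measurable_sph_harmonic R p.1 p.2.
rewrite /random_field; split.
  under eq_fun do rewrite (Re_Im_fourier_sum _ _ _ _).1.
  apply: measurable_sum => p; apply: measurable_funM => //.
  by apply: measurable_funB; [exact: (measurable_field_mul (mF p).1 (mY p).1)|
                              exact: (measurable_field_mul (mF p).2 (mY p).2)].
under eq_fun do rewrite (Re_Im_fourier_sum _ _ _ _).2.
apply: measurable_sum => p; apply: measurable_funM => //.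
by apply: measurable_funD; [exact: (measurable_field_mul (mF p).1 (mY p).2)|
                            exact: (measurable_field_mul (mF p).2 (mY p).1)].
Qed.

(** Pointwise Cauchy-Schwarz with weights e_p gives |sum e_p F_p Y_p|^2 <= (sum e_p)(sum e_p |F_p|^2
    |Y_p|^2). Integrating over the sphere with ||Y_p|| <= 1 and |F_p| <= ||T(w)|| produces the
    second factor sum e_p. *)
Lemma integral_sqr_fourier_sum_le s e : (forall p, 0 <= e p) ->
  (\int[P]_w \int[@sphere_measure R]_(x in sphere)
     (complex.Re (fourier_sum s e w x) ^+ 2 + complex.Im (fourier_sum s e w x) ^+ 2)%:E <=
   ((\sum_(p <- s) e p) ^+ 2)%:E *
   \int[P]_w \int[@sphere_measure R]_(x in sphere) (T w x ^+ 2)%:E)%E.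
Proof.
move=> e0; have mS := @measurable_sphere R.
have [mRe mIm] := random_field_fourier_sum s e.
have se0 : 0 <= \sum_(p <- s) e p by exact: sumr_ge0.
have mT2 : measurable_fun ([set: Omega] `*` @sphere R) (fun p => (T p.1 p.2 ^+ 2)%:E).
  by apply/measurable_EFinP; exact: measurable_funX.
have mV : measurable_fun setT
    (fun w => \int[@sphere_measure R]_(x in sphere) (T w x ^+ 2)%:E)%E.
  by apply: (measurable_integral_sphere mT2) => w x _; rewrite lee_fin sqr_ge0.
have V0 w : (0 <= \int[@sphere_measure R]_(x in sphere) (T w x ^+ 2)%:E)%E.
  by apply: integral_ge0 => x _; rewrite lee_fin sqr_ge0.
have mfs : measurable_fun ([set: Omega] `*` @sphere R) (fun p =>
    (complex.Re (fourier_sum s e p.1 p.2) ^+ 2 + complex.Im (fourier_sum s e p.1 p.2) ^+ 2)%:E).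
  by apply/measurable_EFinP; apply: measurable_funD; exact: measurable_funX.
rewrite -ge0_integralZl// ?lee_fin ?sqr_ge0//.
apply: ge0_le_integral => //.
- by move=> w _; apply: integral_ge0 => x _; rewrite lee_fin addr_ge0 ?sqr_ge0.
- by apply: (measurable_integral_sphere mfs) => w x _; rewrite lee_fin addr_ge0 ?sqr_ge0.
- exact: measurable_funeM.
move=> w _.
have mY p : measurable_fun (@sphere R)
    (fun x => (complex.Re (Y p x) ^+ 2 + complex.Im (Y p x) ^+ 2)%:E).
  have [mR mI] := @measurable_sph_harmonic R p.1 p.2.
  by apply/measurable_EFinP; apply: measurable_funD; exact: measurable_funX.
pose N p := complex.Re (F p w) ^+ 2 + complex.Im (F p w) ^+ 2.
have N0 p : 0 <= N p by rewrite addr_ge0 ?sqr_ge0.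
have se0' : (0 <= (\sum_(p <- s) e p)%:E)%E by rewrite lee_fin.
have eN0 p : (0 <= (e p * N p)%:E)%E by rewrite lee_fin mulr_ge0.
have Y0 p x : (0 <= (complex.Re (Y p x) ^+ 2 + complex.Im (Y p x) ^+ 2)%:E)%E.
  by rewrite lee_fin addr_ge0 ?sqr_ge0.
apply: (@le_trans _ _ (\int[@sphere_measure R]_(x in sphere) ((\sum_(p <- s) e p)%:E *
   \sum_(p <- s) ((e p * N p)%:E *
     (complex.Re (Y p x) ^+ 2 + complex.Im (Y p x) ^+ 2)%:E)))%E).
  apply: ge0_le_integral => //.
  - by move=> x _; rewrite lee_fin addr_ge0 ?sqr_ge0.
  - exact: (measurable_field_section (f := fun w x => (complex.Re (fourier_sum s e w x) ^+ 2 +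
      complex.Im (fourier_sum s e w x) ^+ 2)%:E) w mfs).
  - by apply: measurable_funeM; apply: emeasurable_sum => p; exact: measurable_funeM.
  move=> x _; rewrite (Re_Im_fourier_sum _ _ _ _).1 (Re_Im_fourier_sum _ _ _ _).2.
  under [X in (_ <= _ * X)%E]eq_bigr do rewrite -EFinM.
  rewrite sumEFin -EFinM lee_fin.
  apply: le_trans (lerD (sqr_weighted_sum_le _ _ e0) (sqr_weighted_sum_le _ _ e0)) _.
  rewrite -mulrDr -big_split; apply: ler_wpM2l => //.
  rewrite le_eqVlt; apply/orP; left; apply/eqP; apply: eq_bigr => p _; rewrite /N.
  by move: (F p w) (Y p x) => [a b] [u v] /=; ring.
rewrite ge0_integralZl//; last 2 first.
- by apply: emeasurable_sum => p; exact: measurable_funeM.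
- by move=> x _; apply: sume_ge0 => p _; exact: mule_ge0.
rewrite expr2 EFinM -muleA; apply: lee_wpmul2l => //.
rewrite ge0_integral_sum//; last 2 first.
- by move=> p; exact: measurable_funeM.
- by move=> p x _; exact: mule_ge0.
rewrite -sumEFin ge0_sume_distrl; last by move=> p _; rewrite lee_fin.
apply: lee_sum => p _.
rewrite ge0_integralZl//.
apply: (@le_trans _ _ ((e p * N p)%:E * 1)%E).
  apply: lee_wpmul2l => //; exact: integral_sqr_norm_sph_harmonic_le1.
rewrite mule1 EFinM; apply: lee_wpmul2l; first by rewrite lee_fin.
apply: sqr_fourier_coef_le.
exact: (measurable_field_section (f := T) w mT).
Qed.

End InitialPart.

                                     

(** * Second moment of the noise part *)

Section Noise.
Context {R : realType}.
Implicit Types (x : 3.-tuple R).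

(** Coefficients of the noise part as a [harmonic_sum]. The cut-off l >= L sits in the coefficients,
    so that sums over all degrees up to N can be used; the factor sqrt 2 belongs to orders m >=
    1. *)
Definition noise_coef (A : nat -> R) (J : bool -> nat -> nat -> R) (L l : nat)
    (i : nat * bool) : R :=
  if (L <= l)%N && (i.1 <= l)%N then
    Num.sqrt (A l) * ((if i.1 == 0%N then 1 else Num.sqrt 2) * J i.2 l i.1)
  else 0.

(** The term m = 0 joins the others: sin(0 phi) = 0, so the absent coefficient [a2 l 0] may be set
    to 0. *)
Lemma real_expansionE d (Omega : measurableType d) (l : nat)
    (a1 a2 : nat -> nat -> Omega -> R) w x :
  real_expansion l a1 a2 w x =
  (\sum_(m < l.+1) (if m == 0%N :> nat then 1 else Num.sqrt 2) *
     norm_legendre l m (cos (colatitude x)) *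
     (a1 l m w * trig (nat_of_ord m, false) (longitude x) +
      (if m == 0%N :> nat then 0 else a2 l m w) * trig (nat_of_ord m, true) (longitude x)))%:C%C.
Proof.
rewrite /real_expansion; have [R0 I0] := Re_Im_sph_harmonic x (leq0n l).
have -> : sph_harmonic l 0 x = (norm_legendre l 0 (cos (colatitude x)))%:C%C.
  move: R0 I0; case: (sph_harmonic l 0 x) => u v; rewrite /complex.Re /complex.Im => -> ->.
  by rewrite /trig/= mul0r cos0 sin0 mulr1 mulr0.
rewrite -rmorphM -rmorphD; congr (_%:C%C).
rewrite big_ord_recl; congr (_ + _).
  by rewrite /trig/= mul0r cos0; ring.
rewrite mulr_sumr big_add1 succnK big_mkord; apply: eq_bigr => m _.
have [-> ->] := @Re_Im_sph_harmonic R l m.+1 x (ltn_ord m).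
by rewrite (_ : nat_of_ord (lift ord0 m) = m.+1)//= ; ring.
Qed.

Lemma harmonic_sum_noise (A : nat -> R) (J : bool -> nat -> nat -> R) (L N : nat) x :
  harmonic_sum N.+1 N.+1 (noise_coef A J L) x =
  \sum_(L <= l < N.+1) Num.sqrt (A l) *
   \sum_(m < l.+1) (if m == 0%N :> nat then 1 else Num.sqrt 2) *
     norm_legendre l m (cos (colatitude x)) *
     (J false l m * trig (nat_of_ord m, false) (longitude x) +
      J true l m * trig (nat_of_ord m, true) (longitude x)).
Proof.
rewrite /harmonic_sum; under eq_bigr do rewrite mulr_suml.
rewrite exchange_big/= (big_nat_widenl _ 0)// big_mkord [RHS]big_mkcond/=.
apply: eq_bigr => l _; case: ifPn => [Ll|Ll]; last first.
  by apply: big1 => i _; rewrite /noise_coef (negbTE Ll) !mul0r.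
rewrite -(pair_bigA _ (fun (m : 'I_N.+1) (b : bool) =>
  noise_coef A J L l (nat_of_ord m, b) * norm_legendre l m (cos (colatitude x)) *
  trig (nat_of_ord m, b) (longitude x)))/=.
rewrite mulr_sumr (big_ord_widen N.+1 (fun m => Num.sqrt (A l) *
  ((if m == 0%N then 1 else Num.sqrt 2) * norm_legendre l m (cos (colatitude x)) *
     (J false l m * trig (m, false) (longitude x) +
      J true l m * trig (m, true) (longitude x)))))// [RHS]big_mkcond/=.
apply: eq_bigr => m _; rewrite big_bool/= /noise_coef Ll/= ltnS.
case: ifPn => [_|]; first by ring.
by rewrite -ltnNge => lm; rewrite !mul0r addr0.
Qed.

End Noise.

Section L2.
Context {R : realType} d (Omega : measurableType d) (P : probability Omega R).
Implicit Types (Z : Omega -> 3.-tuple R -> R[i]).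

Definition L2sqr Z : \bar R :=
  (\int[P]_w \int[@sphere_measure R]_(x in sphere)
    (complex.Re (Z w x) ^+ 2 + complex.Im (Z w x) ^+ 2)%:E)%E.

Definition complex_field Z :=
  random_field (fun w x => complex.Re (Z w x)) /\
  random_field (fun w x => complex.Im (Z w x)).

Lemma L2sqr_ge0 Z : (0 <= L2sqr Z)%E.
Proof.
by apply: integral_ge0 => w _; apply: integral_ge0 => x _; rewrite lee_fin addr_ge0 ?sqr_ge0.
Qed.

(** Bounds on norms are exchanged for bounds on squared norms, where expectations add up. *)
Lemma L2norm_le Z (a : R) : 0 <= a ->
  (L2norm P Z <= a%:E)%E = (L2sqr Z <= (a ^+ 2)%:E)%E.
Proof.
move=> a0; rewrite /L2norm -/(L2sqr Z).
have -> : (a%:E = (a ^+ 2)%:E `^ 2^-1)%E.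
  by rewrite poweR_EFin -powR_mulrn// -powRrM divff// powRr1.
apply/idP/idP; last first.
  by apply: gt0_ler_poweR; rewrite ?in_itv/= ?andbT ?L2sqr_ge0 ?leey ?lee_fin ?sqr_ge0 ?invr_ge0.
have E (y : \bar R) : (0 <= y)%E -> ((y `^ 2^-1) `^ 2 = y)%E.
  by move=> y0; rewrite -poweRrM mulVf// poweRe1.
move=> h; rewrite -(E (L2sqr Z)) ?L2sqr_ge0// -(E (a ^+ 2)%:E) ?lee_fin ?sqr_ge0//.
by apply: gt0_ler_poweR => //; rewrite in_itv/= leey andbT ?lee_fin ?powR_ge0 ?poweR_ge0.
Qed.

Lemma measurable_sqr_norm Z : complex_field Z ->
  measurable_fun ([set: Omega] `*` @sphere R)
    (fun p => (complex.Re (Z p.1 p.2) ^+ 2 + complex.Im (Z p.1 p.2) ^+ 2)%:E).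
Proof.
by move=> [mR mI]; apply/measurable_EFinP; apply: measurable_funD; exact: measurable_funX.
Qed.

Lemma L2sqr_add3_le Z Z1 Z2 Z3 : complex_field Z -> complex_field Z1 ->
  complex_field Z2 -> complex_field Z3 ->
  (forall w x, sphere x -> Z w x = Z1 w x + Z2 w x + Z3 w x) ->
  (L2sqr Z <= 3%:E * (L2sqr Z1 + L2sqr Z2 + L2sqr Z3))%E.
Proof.
move=> cZ c1 c2 c3 ZE; have mS := @measurable_sphere R.
pose n Z w x := (complex.Re (Z w x) ^+ 2 + complex.Im (Z w x) ^+ 2)%:E.
have n0 Z' w x : (0 <= n Z' w x)%E by rewrite lee_fin addr_ge0 ?sqr_ge0.
have ms Z' w : complex_field Z' -> measurable_fun (@sphere R) (n Z' w).
  by move=> c; exact: (measurable_field_section (f := n Z') w (measurable_sqr_norm c)).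
pose q Z w := (\int[@sphere_measure R]_(x in sphere) n Z w x)%E.
have q0 Z' w : (0 <= q Z' w)%E by apply: integral_ge0.
have mq Z' : complex_field Z' -> measurable_fun setT (q Z').
  move=> c; apply: (measurable_integral_sphere (f := n Z') (measurable_sqr_norm c)).
  by move=> w x _; exact: n0.
have m12 w : measurable_fun (@sphere R) (fun x => n Z1 w x + n Z2 w x)%E.
  by apply: emeasurable_funD; exact: ms.
have m123 w : measurable_fun (@sphere R) (fun x => n Z1 w x + n Z2 w x + n Z3 w x)%E.
  by apply: emeasurable_funD => //; exact: ms.
have mq12 : measurable_fun setT (fun w => q Z1 w + q Z2 w)%E.
  by apply: emeasurable_funD; exact: mq.
have mq123 : measurable_fun setT (fun w => q Z1 w + q Z2 w + q Z3 w)%E.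
  by apply: emeasurable_funD => //; exact: mq.
apply: (@le_trans _ _ (\int[P]_w (3%:E * (q Z1 w + q Z2 w + q Z3 w)))%E); last first.
  rewrite ge0_integralZl//; last by move=> w _; rewrite adde_ge0// adde_ge0.
  rewrite ge0_integralD//; [|by move=> w _; rewrite adde_ge0|exact: mq].
  by rewrite ge0_integralD//; exact: mq.
apply: ge0_le_integral => //; [by move=> w _; exact: q0|exact: mq|exact: measurable_funeM|].
move=> w _.
apply: (@le_trans _ _ (\int[@sphere_measure R]_(x in sphere)
    (3%:E * (n Z1 w x + n Z2 w x + n Z3 w x)))%E); last first.
  rewrite ge0_integralZl//; last by move=> x _; rewrite adde_ge0// adde_ge0.
  rewrite ge0_integralD//; [|by move=> x _; rewrite adde_ge0|exact: ms].
  by rewrite ge0_integralD//; exact: ms.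
apply: ge0_le_integral => //; [by move=> x _; exact: n0|exact: ms|exact: measurable_funeM|].
move=> x xS; rewrite -!EFinD -EFinM lee_fin ZE//.
case: (Z1 w x) (Z2 w x) (Z3 w x) => [a a'] [b b'] [c c'] /=.
have := sqr_ge0 (a - b); have := sqr_ge0 (a - c); have := sqr_ge0 (b - c).
have := sqr_ge0 (a' - b'); have := sqr_ge0 (a' - c'); have := sqr_ge0 (b' - c').
by nra.
Qed.

Lemma ReD (z1 z2 : R[i]) : complex.Re (z1 + z2) = complex.Re z1 + complex.Re z2.
Proof. by case: z1 z2 => [? ?] [? ?]. Qed.

Lemma ImD (z1 z2 : R[i]) : complex.Im (z1 + z2) = complex.Im z1 + complex.Im z2.
Proof. by case: z1 z2 => [? ?] [? ?]. Qed.

Lemma ReN (z : R[i]) : complex.Re (- z) = - complex.Re z.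
Proof. by case: z. Qed.

Lemma ImN (z : R[i]) : complex.Im (- z) = - complex.Im z.
Proof. by case: z. Qed.

Lemma complex_fieldD Z1 Z2 : complex_field Z1 -> complex_field Z2 ->
  complex_field (fun w x => Z1 w x + Z2 w x).
Proof.
move=> [R1 I1] [R2 I2]; rewrite /complex_field /random_field; split.
  by under eq_fun do rewrite ReD; exact: measurable_funD.
by under eq_fun do rewrite ImD; exact: measurable_funD.
Qed.

Lemma complex_fieldN Z : complex_field Z -> complex_field (fun w x => - Z w x).
Proof.
move=> [R1 I1]; rewrite /complex_field /random_field; split.
  by under eq_fun do rewrite ReN; exact: measurableT_comp.
by under eq_fun do rewrite ImN; exact: measurableT_comp.
Qed.

End L2.

Section NoiseMoment.
Context {R : realType} d (Omega : measurableType d) (P : probability Omega R).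
Variables (A : nat -> R) (J : bool -> nat -> nat -> Omega -> R) (K : R).
Hypothesis A0 : forall l, 0 <= A l.
Hypothesis mJ : forall b l m, (m <= l)%N -> measurable_fun setT (J b l m).
Hypothesis JK : forall b l m, (m <= l)%N -> (\int[P]_w (J b l m w ^+ 2)%:E <= K%:E)%E.

Definition noise_sum (L N : nat) (w : Omega) (x : 3.-tuple R) : R[i] :=
  (harmonic_sum N.+1 N.+1 (noise_coef A (fun b l m => J b l m w) L) x)%:C%C.

Lemma measurable_noise_coef (L l : nat) (i : nat * bool) :
  measurable_fun setT (fun w => noise_coef A (fun b l m => J b l m w) L l i).
Proof.
rewrite /noise_coef; case: (boolP (_ && _)) => [/andP[_ il]|_]; last exact: measurable_cst.
by apply: measurable_funM => //; apply: measurable_funM => //; exact: mJ.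
Qed.

Lemma complex_field_noise_sum (L N : nat) : complex_field (noise_sum L N).
Proof.
split; last exact: measurable_cst.
rewrite /random_field /noise_sum /harmonic_sum /=.
apply: measurable_sum => i.
under eq_fun do rewrite mulr_suml.
apply: measurable_sum => l.
under eq_fun do rewrite -mulrA.
apply: (@measurable_field_mul _ _ _
   (fun w => noise_coef A (fun b l m => J b l m w) L l (ord_key i))
   (fun x => norm_legendre l i.1 (cos (colatitude x)) * trig (ord_key i) (longitude x))).
  exact: measurable_noise_coef.
apply: measurable_funM.
  by apply: measurable_comp_colatitude; exact: continuous_norm_legendre.
by apply: measurable_funTS; exact: measurable_trig_longitude.
Qed.

(** The Parseval weight [trig_weight i / (2 * pi)] is at most 1 and the squared normalisation at
    most 2, whence the constant 2. *)
Lemma second_moment_noise_coef (L l : nat) (i : nat * bool) :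
  (\int[P]_w (noise_coef A (fun b l m => J b l m w) L l i ^+ 2 *
      ((i.1 <= l)%N%:R * (trig_weight i / (2 * pi))))%:E <=
   (if (L <= l)%N && (i.1 <= l)%N then 2 * (A l * K) else 0)%:E)%E.
Proof.
rewrite /noise_coef; case: (boolP (_ && _)) => [/andP[_ il]|_]; last first.
  by rewrite integral0_eq// => w _; rewrite expr0n mul0r.
have pi0 : 0 < pi :> R by exact: pi_gt0.
have w0 : 0 <= trig_weight i / (2 * pi) :> R.
  rewrite /trig_weight divr_ge0 ?mulr_ge0 ?(ltW pi0)//.
  by case: ifP => _; [case: ifP => _|]; rewrite ?mulr_ge0 ?(ltW pi0).
have w1 : trig_weight i / (2 * pi) <= 1 :> R.
  rewrite /trig_weight ler_pdivrMr ?mulr_gt0// mul1r.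
  by case: ifP => _; [case: ifP => _|]; rewrite ?mulr_ge0 ?(ltW pi0)// ler_pMl// ler1n.
have k2 : (if i.1 == 0%N then 1 else Num.sqrt 2) ^+ 2 <= 2 :> R.
  by case: ifP => _; rewrite ?expr1n ?sqr_sqrtr// ler1n.
have mJ2 : measurable_fun setT (fun w => (J i.2 l i.1 w ^+ 2)%:E).
  by apply/measurable_EFinP; apply: measurable_funX; exact: mJ.
apply: (@le_trans _ _ (\int[P]_w ((2 * A l)%:E * (J i.2 l i.1 w ^+ 2)%:E))%E); last first.
  rewrite ge0_integralZl//; last 2 first.
  - by move=> w _; rewrite lee_fin sqr_ge0.
  - by rewrite lee_fin mulr_ge0.
  by rewrite mulrA [leRHS]EFinM; apply: lee_wpmul2l; [rewrite lee_fin mulr_ge0|exact: JK].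
apply: ge0_le_integral => //.
- by move=> w _; rewrite lee_fin il mul1r mulr_ge0 ?sqr_ge0.
- apply/measurable_EFinP; apply: measurable_funM => //; apply: measurable_funX.
  by apply: measurable_funM => //; apply: measurable_funM => //; exact: mJ.
- exact: measurable_funeM.
move=> w _; rewrite -EFinM lee_fin il mul1r !exprMn sqr_sqrtr//.
move: (J _ _ _ _ ^+ 2) (sqr_ge0 (J i.2 l i.1 w)) => j j0.
move: (_ ^+ 2) k2 (sqr_ge0 (if i.1 == 0%N then 1 else Num.sqrt 2 : R)) => k k2 k0.
move: (trig_weight i / _) w0 w1 => v v0 v1.
rewrite (_ : _ * v = A l * j * (k * v)); last by ring.
rewrite (_ : 2 * A l * j = A l * j * 2); last by ring.
by apply: ler_wpM2l; [rewrite mulr_ge0|nra].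
Qed.

(** Degree l has l+1 orders and two parities, each costing at most 2 A_l K. *)
Lemma L2sqr_noise_sum_le (L N : nat) :
  (L2sqr P (noise_sum L N) <=
   (\sum_(L <= l < N.+1) 4 * l.+1%:R * (A l * K))%:E)%E.
Proof.
rewrite /L2sqr /noise_sum /=.
under eq_integral do under eq_integral do rewrite expr0n addr0.
under eq_integral do rewrite integral_harmonic_sum_sqr -sumEFin.
under eq_integral do under eq_bigr do rewrite -sumEFin.
have t0 (w : Omega) (i : 'I_N.+1 * bool) (l : 'I_N.+1) :
    (0 <= (noise_coef A (fun b l m => J b l m w) L l (ord_key i) ^+ 2 *
      ((i.1 <= l)%N%:R * (trig_weight (ord_key i) / (2 * pi))))%:E)%E.
  rewrite lee_fin mulr_ge0 ?sqr_ge0// mulr_ge0// /trig_weight divr_ge0 ?mulr_ge0 ?pi_ge0//.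
  by case: ifP => _; [case: ifP => _|]; rewrite ?mulr_ge0 ?pi_ge0.
have mt (i : 'I_N.+1 * bool) (l : 'I_N.+1) : measurable_fun setT (fun w : Omega =>
    (noise_coef A (fun b l m => J b l m w) L l (ord_key i) ^+ 2 *
      ((i.1 <= l)%N%:R * (trig_weight (ord_key i) / (2 * pi))))%:E).
  apply/measurable_EFinP; apply: measurable_funM => //; apply: measurable_funX.
  exact: measurable_noise_coef.
rewrite ge0_integral_sum//; last 2 first.
- by move=> i; apply: emeasurable_sum => l; exact: mt.
- by move=> i w _; apply: sume_ge0 => l _; exact: t0.
apply: (@le_trans _ _ (\sum_(i : 'I_N.+1 * bool) (\sum_(l < N.+1)
    if (L <= l)%N && (i.1 <= l)%N then 2 * (A l * K) else 0)%R%:E)%E).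
  apply: lee_sum => i _; rewrite -sumEFin ge0_integral_sum//.
  by apply: lee_sum => l _; exact: (second_moment_noise_coef L l (ord_key i)).
rewrite sumEFin lee_fin exchange_big/= (big_nat_widenl _ 0)// big_mkord [leRHS]big_mkcond/=.
rewrite le_eqVlt; apply/orP; left; apply/eqP; apply: eq_bigr => l _.
case: ifPn => Ll/=; last by rewrite big1.
rewrite -(pair_bigA _ (fun (m : 'I_N.+1) (b : bool) =>
  if (m <= l)%N then 2 * (A l * K) else 0))/=.
transitivity (\sum_(m < N.+1) (if (m < l.+1)%N then 4 * (A l * K) else 0)).
  apply: eq_bigr => m _; rewrite big_bool/= ltnS; case: ifP => _; last by rewrite addr0.
  by rewrite -mulrDl -natrD.
rewrite -big_mkcond -(big_ord_widen N.+1 (fun=> 4 * (A l * K)))//.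
by rewrite sumr_const card_ord -mulr_natr; ring.
Qed.

End NoiseMoment.

                             

(** * Decomposition of the truncation error and the final estimate *)

Section KarhunenLoeve.
Context {R : realType} d (Omega : measurableType d).
Variables (alpha gamma t0 : R) (A : nat -> R) (T0 : Omega -> 3.-tuple R -> R).
Variables (I1 I2 : nat -> nat -> R -> Omega -> R) (t : R).

Definition order_pairs (L N : nat) : seq (nat * int) :=
  [seq (l, k%:Z - l%:Z) | l <- index_iota L N.+1, k <- iota 0 (2 * l).+1].

Definition semigroup_weight (p : nat * int) : R :=
  expR (- psi alpha gamma (LB_eigenvalue p.1) * (t + t0)).

                                                                             
                          
(** There is no beta^2 of order 0, and [I2 l 0] is an unconstrained function; replacing it by 0
    makes all coefficients measurable with bounded second moment. *)
Definition noise_integral (b : bool) (l m : nat) (w : Omega) : R :=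
  if b then (if m == 0%N then 0 else I2 l m t w) else I1 l m t w.

Definition KL_term (l : nat) (w : Omega) (x : 3.-tuple R) : R[i] :=
  sum_orders l (fun m =>
    (expR (- psi alpha gamma (LB_eigenvalue l) * (t + t0)))%:C%C *
    fourier_coef (fun y => (T0 w y)%:C%C) l m * sph_harmonic l m x) +
  (Num.sqrt (A l))%:C%C *
  real_expansion l (fun l m => I1 l m t) (fun l m => I2 l m t) w x.

Lemma sum_KL_term (L N : nat) w x : \sum_(L <= l < N.+1) KL_term l w x =
  fourier_sum T0 (order_pairs L N) semigroup_weight w x +
  noise_sum A noise_integral L N w x.
Proof.
rewrite big_split /=; congr (_ + _).
  rewrite /fourier_sum /order_pairs big_allpairs_dep/=; apply: eq_bigr => l _.
  rewrite /sum_orders -(big_mkord xpredT (fun k : nat => (expR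
      (- psi alpha gamma (LB_eigenvalue l) * (t + t0)))%:C%C *
    fourier_coef (fun y => (T0 w y)%:C%C) l (k%:Z - l%:Z) * sph_harmonic l (k%:Z - l%:Z) x)).
  by rewrite /index_iota subn0.
rewrite /noise_sum harmonic_sum_noise rmorph_sum; apply: eq_bigr => l _.
by rewrite rmorphM; congr (_ * _); rewrite real_expansionE.
Qed.

Lemma KL_approxE (N : nat) w x :
  KL_approx alpha gamma t0 A T0 I1 I2 t N w x = \sum_(0 <= l < N.+1) KL_term l w x.
Proof. by rewrite big_mkord. Qed.

Lemma KL_approxB (L N : nat) w x : (L <= N)%N ->
  KL_approx alpha gamma t0 A T0 I1 I2 t N w x -
    KL_approx alpha gamma t0 A T0 I1 I2 t L w x =
  fourier_sum T0 (order_pairs L.+1 N) semigroup_weight w x +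
  noise_sum A noise_integral L.+1 N w x.
Proof.
move=> LN; rewrite -sum_KL_term !KL_approxE (@big_cat_nat _ _ _ L.+1)//=.
by rewrite addrAC subrr add0r.
Qed.

Lemma sum_semigroup_weight (L N : nat) : \sum_(p <- order_pairs L N) semigroup_weight p =
  \sum_(L <= l < N.+1) (2 * l).+1%:R * expR (- psi alpha gamma (LB_eigenvalue l) * (t + t0)).
Proof.
rewrite /order_pairs big_allpairs_dep; apply: eq_bigr => l _.
rewrite -[LHS]/(\sum_(k <- iota 0 (2 * l).+1)
  expR (- psi alpha gamma (LB_eigenvalue l) * (t + t0))).
by rewrite big_const_seq count_predT size_iota iter_addr addr0 mulr_natl.
Qed.

End KarhunenLoeve.

Lemma psi_ge0 (R : realType) (alpha gamma u : R) : 0 <= psi alpha gamma u.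
Proof. by rewrite mulr_ge0// powR_ge0. Qed.

Lemma noise_integral_moment (R : realType) (d : measure_display)
    (Omega : measurableType d) (P : probability Omega R) (alpha gamma H t : R)
    (b1 b2 I1 I2 : nat -> nat -> R -> Omega -> R) b l m :
  1 / 2 <= H -> H < 1 -> 0 < t -> independent_fBms P H b1 b2 ->
  stochastic_convolutions P alpha gamma b1 b2 I1 I2 -> (m <= l)%N ->
  measurable_fun setT (noise_integral I1 I2 t b l m) /\
  (\int[P]_w (noise_integral I1 I2 t b l m w ^+ 2)%:E <=
    (8 * (1 + t ^+ 2) + 3)%:E)%E.
Proof.
move=> H2 H1 t_gt0 [fb _] cI ml.
have [cI1 cI2] := cI l m t ml (ltW t_gt0).
rewrite /noise_integral; case: b; last first.
  have h1 : is_fBm P H (b1 l m) by apply: (fb (false, l, m)); split.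
  exact: stochastic_convolution_second_moment H2 H1 (psi_ge0 _ _ _) t_gt0 h1 cI1.
have [_|m0] := eqVneq m 0%N.
  split; first exact: measurable_cst.
  rewrite integral0_eq; last by move=> w _; rewrite expr0n.
  by rewrite lee_fin addr_ge0// mulr_ge0// addr_ge0// sqr_ge0.
rewrite -lt0n in m0.
have h2 : is_fBm P H (b2 l m) by apply: (fb (true, l, m)); split.
exact: stochastic_convolution_second_moment H2 H1 (psi_ge0 _ _ _) t_gt0 h2 (cI2 m0).
Qed.

(** For l > L, (1+l)^(2r+1) = (1+l)((1+l)^r)^2 and L^(-r)(1+l)^r >= 1, so each term is dominated by
    L^(-2r) times a term of the series bounded by S. *)
Lemma noise_tail_le (R : realType) (A : nat -> R) (r S K : R) (L N : nat) :
  (forall l, 0 <= A l) -> 0 <= K -> 0 <= r -> (0 < L)%N ->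
  (forall n, \sum_(0 <= l < n) A l * (1 + l%:R) `^ (2 * r + 1) <= S) ->
  \sum_(L.+1 <= l < N.+1) 4 * l.+1%:R * (A l * K) <= 4 * K * S * (L%:R `^ (- r)) ^+ 2.
Proof.
move=> A0 K0 r0 L0 AS.
have Lr0 : 0 <= (L%:R `^ (- r)) ^+ 2 :> R by exact: sqr_ge0.
have p0 l : 0 <= A l * (1 + l%:R) `^ (2 * r + 1) by rewrite mulr_ge0// powR_ge0.
apply: (@le_trans _ _ (\sum_(L.+1 <= l < N.+1) 4 * K * (L%:R `^ (- r)) ^+ 2 *
    (A l * (1 + l%:R) `^ (2 * r + 1)))).
  rewrite big_nat [leRHS]big_nat; apply: ler_sum => l /andP[Ll _].
  have l1 : 0 < 1 + l%:R :> R by rewrite ltr_pwDl.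
  have E : (1 + l%:R) `^ (2 * r + 1) = (1 + l%:R) * ((1 + l%:R) `^ r) ^+ 2 :> R.
    rewrite powRD; last by rewrite (gt_eqF l1) implybT.
    by rewrite powRr1 ?(ltW l1)// mulrC -powR_mulrn ?powR_ge0// -powRrM [r * _]mulrC.
  have h : 1 <= L%:R `^ (- r) * (1 + l%:R) `^ r :> R.
    rewrite powRN mulrC ler_pdivlMr ?powR_gt0 ?ltr0n// mul1r.
    apply: (ge0_ler_powR r0); rewrite ?nnegrE ?(ltW l1)//.
    by rewrite addrC natr1 ler_nat; exact: leqW (ltnW Ll).
  rewrite E -[l.+1%:R]natr1 [l%:R + 1]addrC.
  move: (1 + l%:R) (L%:R `^ (- r)) ((1 + l%:R) `^ r) l1 h => x y z x0 h.
  rewrite (_ : 4 * x * _ = 4 * x * (A l * K) * 1); last by rewrite mulr1.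
  rewrite (_ : 4 * K * _ * _ = 4 * x * (A l * K) * (y * z) ^+ 2); last by ring.
  apply: ler_wpM2l; first by rewrite !mulr_ge0// ltW.
  by rewrite expr_ge1// (le_trans ler01).
rewrite -mulr_sumr [leRHS]mulrAC; apply: ler_wpM2l; first by rewrite !mulr_ge0.
apply: le_trans (AS N.+1); rewrite (big_nat_widenl _ 0)//= [leRHS]big_mkord big_mkord.
by rewrite big_mkcond/=; apply: ler_sum => l _; case: ifP.
Qed.

(** The convergence takes place in the extended reals; [fine_cvgP] makes the norms finite from some
    rank on, and [maxn] secures N >= L. *)
Lemma exists_L2_close (R : realType) (d : measure_display) (Omega : measurableType d)
    (P : probability Omega R) (S : nat -> Omega -> 3.-tuple R -> R[i])
    (Z : Omega -> 3.-tuple R -> R[i]) (L : nat) (e : R) : 0 < e ->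
  is_L2_limit P S Z -> exists2 N, (L <= N)%N &
    (L2norm P (fun w x => Z w x - S N w x)%R <= e%:E)%E.
Proof.
move=> e0 [_ _ /fine_cvgP[Sfin Scvg]].
have Se : \forall N \near \oo, fine (L2norm P (fun w x => Z w x - S N w x)%R) < e.
  exact: (cvgr_lt _ Scvg).
have [N _ hN] : \forall N \near \oo, (L2norm P (fun w x => Z w x - S N w x)%R <= e%:E)%E.
  near=> N; rewrite -[leLHS]fineK; last by near: N.
  by rewrite lee_fin ltW//; near: N.
by exists (maxn L N); rewrite ?leq_maxl//; apply: hN; rewrite /= leq_maxr.
Unshelve. all: by end_near.
Qed.

Theorem theorem4p7 (R : realType) (d : measure_display)
    (Omega : measurableType d) (P : probability Omega R)
    (T0 : Omega -> 3.-tuple R -> R) (A : nat -> R) :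
  random_field T0 -> gaussian_field P T0 ->
  centered_field P T0 -> weakly_isotropic2 P T0 ->
  (forall l, 0 < A l) ->
  (\sum_(0 <= l <oo) ((2 * l + 1)%:R * A l)%:E < +oo)%E ->
  forall alpha gamma t0 t r : R,
    0 <= alpha -> 0 < gamma -> 0 <= t0 -> 0 < t -> 1 < r ->
    (\sum_(0 <= l <oo) (A l * (1 + l%:R) `^ (2 * r + 1))%:E < +oo)%E ->
  exists C : R,
    forall (H : R) (b1 b2 I1 I2 : nat -> nat -> R -> Omega -> R)
           (B X : R -> Omega -> 3.-tuple R -> R[i]) (L : nat),
      1 / 2 <= H -> H < 1 ->
      is_sphere_fBm P H A b1 b2 B ->
      stochastic_convolutions P alpha gamma b1 b2 I1 I2 ->
      is_KL_solution P alpha gamma t0 A T0 I1 I2 X ->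
      (1 <= L)%N ->
      (L2norm P (fun w x =>
         (X t w x - KL_approx alpha gamma t0 A T0 I1 I2 t L w x)%R)
         <= (C * L%:R `^ (- r))%:E)%E.
Proof.
move=> mT _ _ isoT Apos _ alpha gamma t0 t r alpha0 gamma0 t00 t_gt0 r1 Ar.
have r0 : 0 <= r by exact: le_trans (ltW r1).
have A0 l : 0 <= A l by exact: ltW.
have [C1 C10 hC1] := decay_sum alpha0 gamma0 t_gt0 t00 r0.
have V0fin := isotropic_second_moment_lty mT isoT.
set V0 := (\int[P]_w _)%E in V0fin.
have V00 : (0 <= V0)%E.
  by apply: integral_ge0 => w _; apply: integral_ge0 => x _; rewrite lee_fin sqr_ge0.
have V0E : V0 = (fine V0)%:E by rewrite fineK// ge0_fin_numE.
have fV0 : 0 <= fine V0 by exact: fine_ge0.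
have u0 l : (0 <= (A l * (1 + l%:R) `^ (2 * r + 1))%:E)%E.
  by rewrite lee_fin mulr_ge0// powR_ge0.
pose S := fine (\sum_(0 <= l <oo) (A l * (1 + l%:R) `^ (2 * r + 1))%:E)%E.
have SE : (\sum_(0 <= l <oo) (A l * (1 + l%:R) `^ (2 * r + 1))%:E)%E = S%:E.
  by rewrite fineK// ge0_fin_numE//; apply: nneseries_ge0.
have AS n : \sum_(0 <= l < n) A l * (1 + l%:R) `^ (2 * r + 1) <= S.
  by rewrite -lee_fin -SE -sumEFin; apply: nneseries_lim_ge.
have S0 : 0 <= S by have := AS 0%N; rewrite big_geq.
pose K := 8 * (1 + t ^+ 2) + 3.
have K0 : 0 <= K by rewrite addr_ge0// mulr_ge0// addr_ge0// sqr_ge0.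
(* The 3 comes from squaring a sum of three terms; inside, 1 accounts for X - X_N, the second term
   for the initial field and the last for the noise, each in units of [rate ^+ 2]. *)
pose C2 := 3 * (1 + C1 ^+ 2 * fine V0 + 4 * K * S).
have C20 : 0 <= C2 by rewrite mulr_ge0// !addr_ge0// !mulr_ge0// sqr_ge0.
exists (Num.sqrt C2) => H b1 b2 I1 I2 B X L H2 H1 [fb _] cI KLX L1.
pose rate := L%:R `^ (- r) : R.
have rate0 : 0 < rate by rewrite powR_gt0 ?ltr0n.
have limX := KLX t (ltW t_gt0).
(* N may depend on everything, as the bounds on the two finite tails below are uniform in N. *)
have [N LN XN] := exists_L2_close L rate0 limX.
rewrite L2norm_le ?mulr_ge0 ?sqrtr_ge0 ?(ltW rate0)//.
rewrite L2norm_le ?(ltW rate0)// in XN.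
have mJ b l m (ml : (m <= l)%N) := (noise_integral_moment b H2 H1 t_gt0 fb cI ml).1.
have JK b l m (ml : (m <= l)%N) := (noise_integral_moment b H2 H1 t_gt0 fb cI ml).2.
pose J := noise_integral I1 I2 t.
pose Z1 w x := X t w x - KL_approx alpha gamma t0 A T0 I1 I2 t N w x.
pose Z2 := fourier_sum T0 (order_pairs L.+1 N) (semigroup_weight alpha gamma t0 t).
pose Z3 := noise_sum A J L.+1 N.
have c2 : complex_field Z2 by exact: random_field_fourier_sum.
have c3 : complex_field Z3 by exact: complex_field_noise_sum.
have c1 : complex_field Z1.
  case: limX => mRe mIm _.
  apply: (complex_fieldD (conj mRe mIm)); apply: complex_fieldN.
  rewrite (_ : KL_approx _ _ _ _ _ _ _ _ _ = fun w x =>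
    fourier_sum T0 (order_pairs 0 N) (semigroup_weight alpha gamma t0 t) w x +
    noise_sum A J 0 N w x).
    by apply: complex_fieldD; [exact: random_field_fourier_sum|exact: complex_field_noise_sum].
  by apply/funext => w; apply/funext => x; rewrite KL_approxE sum_KL_term.
have ZE w x : X t w x - KL_approx alpha gamma t0 A T0 I1 I2 t L w x =
    Z1 w x + Z2 w x + Z3 w x.
  by rewrite -addrA -KL_approxB// /Z1 addrA subrK.
have cZ : complex_field (fun w x => X t w x - KL_approx alpha gamma t0 A T0 I1 I2 t L w x).
  rewrite (_ : (fun w x => _) = (fun w x => Z1 w x + Z2 w x + Z3 w x)).
    by apply: complex_fieldD => //; exact: complex_fieldD.
  by apply/funext => w; apply/funext => x.
apply: (le_trans (L2sqr_add3_le P cZ c1 c2 c3 (fun w x _ => ZE w x))).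
have Z2le : (L2sqr P Z2 <= (C1 ^+ 2 * fine V0 * rate ^+ 2)%:E)%E.
  apply: (le_trans (integral_sqr_fourier_sum_le _ mT _ _)).
    by move=> p; exact: expR_ge0.
  rewrite -/V0 V0E -EFinM lee_fin [leRHS]mulrAC; apply: ler_wpM2r => //.
  rewrite -exprMn sum_semigroup_weight lerXn2r ?nnegrE ?mulr_ge0 ?(ltW rate0)//.
    by apply: sumr_ge0 => l _; rewrite mulr_ge0// expR_ge0.
  exact: hC1.
have Z3le : (L2sqr P Z3 <= (4 * K * S * rate ^+ 2)%:E)%E.
  apply: (le_trans (L2sqr_noise_sum_le A0 mJ JK _ _)).
  by rewrite lee_fin; exact: noise_tail_le.
rewrite (_ : (Num.sqrt C2 * _) ^+ 2 = 3 * (rate ^+ 2 + C1 ^+ 2 * fine V0 * rate ^+ 2 +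
    4 * K * S * rate ^+ 2)).
  rewrite EFinM; apply: lee_wpmul2l => //; rewrite !EFinD.
  by apply: leeD => //; exact: leeD.
by rewrite exprMn sqr_sqrtr// /C2 -/rate; ring.
Qed.
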